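(* Let $f:\Omega\to\mathbb O$ be a slice regular function on a symmetric slice domain $\Omega\subseteq\mathbb O$. If $|f|$ attains a local minimum at some point $w_0\in\Omega\cap\mathbb R$, then either $f(w_0)=0$ or $f$ is constant.
   Context: $\mathbb O$ is the real division algebra of octonions, with norm $|w|$. $\mathbb S=\{w\in\mathbb O:w^2=-1\}$; for $I\in\mathbb S$, $\mathbb C_I=\mathbb R\oplus I\mathbb R$ and $\Omega_I=\Omega\cap\mathbb C_I$. $f:\Omega\to\mathbb O$ on a domain $\Omega\subseteq\mathbb O$ is slice regular if for every $I\in\mathbb S$ its restriction $f_I$ to $\Omega_I$ has continuous partial derivatives and $\frac12(\frac{\partial}{\partial x}+I\frac{\partial}{\partial y})f_I(x+yI)=0$ on $\Omega_I$. A symmetric slice domain is a domain $\Omega\subseteq\mathbb O$ that intersects the real axis, such that $\Omega_I$ is a domain in $\mathbb C_I$ for every $I\in\mathbb S$, and such that $x+yI\in\Omega$ (with $x,y\in\mathbb R$, $I\in\mathbb S$) implies $x+y\mathbb S\subseteq\Omega$. *)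

(* Defs.v *)
From HB Require Import structures.
From mathcomp Require Import all_boot all_order all_algebra.
From mathcomp Require Import all_classical all_reals all_analysis.
From mathcomp Require Import ring.
Set Implicit Arguments.
Unset Strict Implicit.
Unset Printing Implicit Defensive.
Import Order.TTheory GRing.Theory Num.Theory.
Import numFieldNormedType.Exports.
Local Open Scope classical_set_scope.
Local Open Scope ring_scope.

(* Cayley-Dickson doubling, with the convention
   (a, b) (c, d) = (a c - d^* b, d a + b c^* ). *)
Section CayleyDickson.
Variables (A : zmodType) (mul : A -> A -> A) (conj : A -> A).

Definition cd_mul (x y : A * A) : A * A :=
  (mul x.1 y.1 - mul (conj y.2) x.2, mul y.2 x.1 + mul x.2 (conj y.1)).

Definition cd_conj (x : A * A) : A * A := (conj x.1, - x.2).
End CayleyDickson.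

(* The octonions over R, as R^8 in the form of nested pairs: addition, real
   scaling and topology are the library's on products.  The library norm
   [`|w|] on a product is the maximum norm; the Euclidean norm of the
   octonions is [onorm] below, and it induces the same topology. *)
Section Octonions.
Variable R : realType.

Definition cpx := (R * R)%type.
Definition quat := (cpx * cpx)%type.
Definition oct := (quat * quat)%type.

Definition cmul : cpx -> cpx -> cpx := cd_mul *%R id.
Definition cconj : cpx -> cpx := cd_conj id.
Definition qmul : quat -> quat -> quat := cd_mul cmul cconj.
Definition qconj : quat -> quat := cd_conj cconj.
Definition omul : oct -> oct -> oct := cd_mul qmul qconj.
Definition oconj : oct -> oct := cd_conj qconj.

Definition oreal (r : R) : oct := (((r, 0), (0, 0)), ((0, 0), (0, 0))).

Definition cnormsq (z : cpx) : R := z.1 ^+ 2 + z.2 ^+ 2.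
Definition qnormsq (q : quat) : R := cnormsq q.1 + cnormsq q.2.
Definition onormsq (w : oct) : R := qnormsq w.1 + qnormsq w.2.
Definition onorm (w : oct) : R := Num.sqrt (onormsq w).

Lemma omul_conj (w : oct) : omul w (oconj w) = oreal (onormsq w).
Proof.
case: w => [[[a b] [c d]] [[a' b'] [c' d']]].
by congr (((_, _), (_, _)), ((_, _), (_, _)));
  rewrite /onormsq /qnormsq /cnormsq /=; ring.
Qed.

Lemma onormsqM (v w : oct) : onormsq (omul v w) = onormsq v * onormsq w.
Proof.
case: v => [[[a b] [c d]] [[a' b'] [c' d']]].
case: w => [[[e f] [g h]] [[e' f'] [g' h']]].
rewrite /onormsq /qnormsq /cnormsq /=; ring.
Qed.

Definition real_axis : set oct := range oreal.

Definition im_units : set oct := [set w | omul w w = - oreal 1].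

(* x + y I *)
Definition slice_pt (I : oct) (p : R * R) : oct := oreal p.1 + p.2 *: I.

Definition slice_plane (I : oct) : set oct := range (slice_pt I).

Definition slice (Omega : set oct) (I : oct) : set oct :=
  Omega `&` slice_plane I.

(* A is a domain of the subspace C: nonempty, connected and open in C. *)
Definition domain_in (T : topologicalType) (C A : set T) : Prop :=
  [/\ A !=set0, connected A & exists2 U, open U & A = U `&` C].

Definition domain (T : topologicalType) (A : set T) : Prop :=
  [/\ A !=set0, connected A & open A].

Definition symmetric_slice_domain (Omega : set oct) : Prop :=
  [/\ domain Omega,
      Omega `&` real_axis !=set0,
      forall I, im_units I -> domain_in (slice_plane I) (slice Omega I) &
      forall x y I, im_units I -> Omega (slice_pt I (x, y)) ->
        forall J, im_units J -> Omega (slice_pt J (x, y))].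

(* A function Omega -> oct is a total function of which only the values on
   Omega are used.  The restriction f_I is read in the coordinates (x, y) of
   the plane C_I, where the partial derivatives are the derivatives in the
   directions (1, 0) and (0, 1). *)
Definition slice_regular (Omega : set oct) (f : oct -> oct) : Prop :=
  forall I, im_units I ->
    let fI := f \o slice_pt I in
    let D := slice_pt I @^-1` Omega in
    [/\ forall p, D p -> derivable fI p (1, 0) /\ derivable fI p (0, 1),
        {within D, continuous (fun p => 'D_(1, 0) fI p)},
        {within D, continuous (fun p => 'D_(0, 1) fI p)} &
        forall p, D p ->
          2^-1 *: ('D_(1, 0) fI p + omul I ('D_(0, 1) fI p)) = 0].

Definition local_min_on (Omega : set oct) (g : oct -> R) (w0 : oct) : Prop :=
  \forall w \near w0, Omega w -> g w0 <= g w.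

Definition constant_on (Omega : set oct) (f : oct -> oct) : Prop :=
  exists c, forall w, Omega w -> f w = c.

End Octonions.

(* Main.v *)
(* Left multiplication by I is a complex structure on the octonions, so each
   coordinate of f_I is the real part of a holomorphic function of x + y i.
   Near w0 the restrictions are f_J = alpha + J beta with one holomorphic
   alpha + i beta.  The minimum over J of |alpha + J beta|^2 and the maximum
   have product |N|^2 for the holomorphic function
   N = |alpha|^2 - |beta|^2 + 2 i <alpha, beta>, so a local minimum c > 0 of
   |f|^2 at w0 gives |N| >= c = N(w0).  The maximum principle for 1/N makes N
   constant, which forces beta = 0 and then alpha constant; the identity
   principle on every slice concludes.

   The function theory rests on the mean value property only: it gives the
   maximum principle, hence three-circles estimates, and these give the identity
   principle (from h / (z - q)^n with n large) and the strong maximum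
   principle (from h^m / (z - q) with m large). *)

Require Import Defs.
From HB Require Import structures.
From mathcomp Require Import all_boot all_order all_algebra.
From mathcomp Require Import all_classical all_reals all_analysis.
From mathcomp Require Import ring lra.
Set Implicit Arguments.
Unset Strict Implicit.
Unset Printing Implicit Defensive.
Import Order.TTheory GRing.Theory Num.Theory.
Import numFieldNormedType.Exports.
Local Open Scope classical_set_scope.
Local Open Scope ring_scope.

(** * Differentiability of real functions of two variables *)

Section Calculus.
Variable R : realType.
Implicit Types (u v a b : R * R -> R) (p q z : R * R) (D : set (R * R)).

Definition lin2 (s t : R) : R * R -> R := fun h => s * h.1 + t * h.2.

Lemma lin2_linear s t : linear (lin2 s t).
Proof. by move=> k x y; rewrite /lin2 /= /GRing.scale /=; ring. Qed.

HB.instance Definition _ s t :=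
  GRing.isLinear.Build R (R * R)%type R _ (lin2 s t) (lin2_linear s t).

Lemma lin2_continuous s t : continuous (lin2 s t).
Proof.
move=> p; rewrite /lin2; apply: cvgD; apply: cvgM;
  by [exact: cvg_cst | exact: cvg_fst | exact: cvg_snd].
Qed.

(** Unfolds the little-o of [is_diff] once; reflection, gluing and tests along the axis can then use
    explicit estimates. *)
Lemma is_diff_lin2P u s t p :
  is_diff p u (lin2 s t) <->
  forall e : R, 0 < e ->
    \forall h \near (0 : R * R), `|u (h + p) - u p - lin2 s t h| <= e * `|h|.
Proof.
split=> [[du ud] e e0|H].
  have /diff_locally := du; rewrite ud.
  move=> /eqaddoP /(_ _ e0).
  apply: filterS => h /=.
  by rewrite -!/((_ : _ -> _) _) !fctE /= opprD addrA.
have E : u \o shift p = cst (u p) + (lin2 s t : R * R -> R^o) +o_ (0 : R * R) id.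
  apply/eqaddoP => e e0; have := H e e0; apply: filterS => h.
  have -> // : (u \o shift p - (cst (u p) + (lin2 s t : _ -> R^o))) h
    = u (h + p) - u p - lin2 s t h.
  by rewrite !fctE opprD addrA.
have dE : 'd u p = lin2 s t :> (R * R -> R).
  exact: (diff_unique (@lin2_continuous s t) E).
split=> //; apply/diff_locallyP; rewrite dE; split => //.
exact: lin2_continuous.
Qed.

Lemma near_prodP (P : R * R -> Prop) p :
  (\forall z \near p, P z) <->
  exists2 d : R, 0 < d & forall z, `|z.1 - p.1| < d -> `|z.2 - p.2| < d -> P z.
Proof.
split=> [/nbhs_ballP[d /= d0 H]|[d d0 H]]; last apply/nbhs_ballP.
  exists d => // z z1 z2; apply: H; split; rewrite /= -ball_normE /=;
  by rewrite distrC.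
exists d => //= z [z1 z2]; apply: H.
  by move: z1; rewrite -ball_normE /= distrC.
by move: z2; rewrite -ball_normE /= distrC.
Qed.

(** The intermediate point is located by its distance to [x], which spares the callers a case
    distinction on the order of [x] and [y]. *)
Lemma MVT_between (f df : R -> R) (x y : R) :
  (forall t, `|t - x| <= `|y - x| -> is_derive t 1 f (df t)) ->
  exists2 c, `|c - x| <= `|y - x| & f y - f x = df c * (y - x).
Proof.
move=> H.
have cf (s t : R) : (forall w, w \in `[s, t]%R -> `|w - x| <= `|y - x|) ->
    {within `[s, t], continuous f}.
  move=> K; apply: derivable_within_continuous => w wst.
  by case: (H w (K w wst)).
case: (leP x y) => xy.
  have K w : w \in `[x, y]%R -> `|w - x| <= `|y - x|.
    rewrite in_itv /= => /andP[xw wy]; rewrite !ger0_norm ?subr_ge0 //.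
    by rewrite lerD2r.
  have [w|c cxy E] := @MVT_segment _ f df _ _ xy _ (cf _ _ K).
    by rewrite in_itv /= => /andP[xw wy]; apply/H/K; rewrite in_itv /= !ltW.
  by exists c => //; exact: K.
have K w : w \in `[y, x]%R -> `|w - x| <= `|y - x|.
  rewrite in_itv /= => /andP[yw wx]; rewrite !ler0_norm ?subr_le0 ?(ltW xy) //.
  by rewrite lerN2 lerD2r.
have [w|c cxy E] := @MVT_segment _ f df _ _ (ltW xy) _ (cf _ _ K).
  by rewrite in_itv /= => /andP[xw wy]; apply/H/K; rewrite in_itv /= !ltW.
exists c => //; first exact: K.
by rewrite -opprB E -mulrN opprB.
Qed.

Lemma is_derive_fst u (x y : R) : derivable u (x, y) (1, 0) ->
  is_derive x 1 (fun t => u (t, y)) ('D_(1, 0) u (x, y)).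
Proof.
have E : (fun h : R => h^-1 *: (((fun t => u (t, y)) \o shift x) (h *: 1) - u (x, y)))
       = (fun h => h^-1 *: ((u \o shift (x, y)) (h *: (1, 0)) - u (x, y))).
  apply/funext => h /=; congr (_ *: (u _ - _)).
  by congr pair; rewrite /= ?scaler0 ?add0r.
move=> du; split; first by rewrite /derivable E.
by rewrite /derive E.
Qed.

Lemma is_derive_snd u (x y : R) : derivable u (x, y) (0, 1) ->
  is_derive y 1 (fun t => u (x, t)) ('D_(0, 1) u (x, y)).
Proof.
have E : (fun h : R => h^-1 *: (((fun t => u (x, t)) \o shift y) (h *: 1) - u (x, y)))
       = (fun h => h^-1 *: ((u \o shift (x, y)) (h *: (0, 1)) - u (x, y))).
  apply/funext => h /=; congr (_ *: (u _ - _)).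
  by congr pair; rewrite /= ?scaler0 ?add0r.
move=> du; split; first by rewrite /derivable E.
by rewrite /derive E.
Qed.

(** The increment from [p] to [h + p] is split at the corner [(p.1, h.2 + p.2)]. The mean value
    theorem on each leg and the continuity of the partial derivatives at [p] bound the error. *)
Lemma is_diff_C1 u p :
  (\forall z \near p, derivable u z (1, 0) /\ derivable u z (0, 1)) ->
  {for p, continuous (fun z => 'D_(1, 0) u z)} ->
  {for p, continuous (fun z => 'D_(0, 1) u z)} ->
  is_diff p u (lin2 ('D_(1, 0) u p) ('D_(0, 1) u p)).
Proof.
move=> du c1 c2; apply/is_diff_lin2P => e e0.
have e20 : 0 < e / 2 by rewrite divr_gt0.
move/cvgrPdist_le/(_ _ e20)/near_prodP: c1 => [d1 d10 c1].
move/cvgrPdist_le/(_ _ e20)/near_prodP: c2 => [d2 d20 c2].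
move/near_prodP: du => [d3 d30 du].
pose d := Num.min d1 (Num.min d2 d3).
have d0 : 0 < d by rewrite !lt_min d10 d20.
apply/near_prodP; exists d => // h; rewrite /= !subr0 => h1 h2.
have Hd z : `|z.1 - p.1| <= `|h.1| -> `|z.2 - p.2| <= `|h.2| ->
    [/\ derivable u z (1, 0) /\ derivable u z (0, 1),
     `|'D_(1, 0) u p - 'D_(1, 0) u z| <= e / 2 &
     `|'D_(0, 1) u p - 'D_(0, 1) u z| <= e / 2].
  move=> /le_lt_trans/(_ h1) + /le_lt_trans/(_ h2).
  rewrite !lt_min => /and3P[? ? ?] /and3P[? ? ?].
  by split; [exact: du|exact: c1|exact: c2].
have [|s s1 Es] := @MVT_between (fun t => u (t, h.2 + p.2))
    (fun t => 'D_(1, 0) u (t, h.2 + p.2)) p.1 (h.1 + p.1).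
  move=> t; rewrite addrK => tp; apply: is_derive_fst.
  by have [|/=|[]] := Hd (t, h.2 + p.2); rewrite //= addrK.
have [|r r1 Er] := @MVT_between (fun t => u (p.1, t))
    (fun t => 'D_(0, 1) u (p.1, t)) p.2 (h.2 + p.2).
  move=> t; rewrite addrK => tp; apply: is_derive_snd.
  by have [|/=|[]] := Hd (p.1, t); rewrite //= subrr normr0.
rewrite addrK in s1; rewrite addrK in r1.
have [_ Ds _] : [/\ True, `|'D_(1, 0) u p - 'D_(1, 0) u (s, h.2 + p.2)| <= e / 2 & True].
  by have [|/=|] := Hd (s, h.2 + p.2); rewrite //= addrK.
have [_ Dr _] : [/\ True, `|'D_(0, 1) u p - 'D_(0, 1) u (p.1, r)| <= e / 2 & True].
  by have [|/=|] := Hd (p.1, r); rewrite //= subrr normr0.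
rewrite !addrK in Es Er.
have -> : u (h + p) - u p - lin2 ('D_(1, 0) u p) ('D_(0, 1) u p) h =
   - (('D_(1, 0) u p - 'D_(1, 0) u (s, h.2 + p.2)) * h.1) -
   (('D_(0, 1) u p - 'D_(0, 1) u (p.1, r)) * h.2).
  rewrite [h + p]surjective_pairing [in u p](surjective_pairing p) /=.
  rewrite /lin2.
  have -> : u (h.1 + p.1, h.2 + p.2) - u (p.1, p.2) =
    (u (h.1 + p.1, h.2 + p.2) - u (p.1, h.2 + p.2)) + (u (p.1, h.2 + p.2) - u (p.1, p.2)).
    by ring.
  by rewrite Es Er; ring.
apply: le_trans (ler_normB _ _) _; rewrite normrN !normrM.
have hn1 : `|h.1| <= `|h| by rewrite prod_normE le_max lexx.
have hn2 : `|h.2| <= `|h| by rewrite prod_normE le_max lexx orbT.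
rewrite [e in leRHS]splitr mulrDl; apply: lerD; apply: ler_pM => //.
Qed.
End Calculus.

(** * Holomorphic functions as pairs of real functions *)

Section Holomorphic.
Variable R : realType.
Implicit Types (u v a b : R * R -> R) (p q z : R * R) (D : set (R * R)).

(* [u + i v] is continuously complex differentiable at the points of [D],
   with derivative [a + i b]. *)
Definition hol D u v := exists a b, forall p, D p ->
  [/\ {for p, continuous a}, {for p, continuous b},
      is_diff p u (lin2 (a p) (- b p)) & is_diff p v (lin2 (b p) (a p))].

Lemma is_diff_cont u du p : is_diff p u du -> {for p, continuous u}.
Proof. by case=> h _; exact: differentiable_continuous. Qed.

Lemma hol_cont D u v p : hol D u v -> D p ->
  {for p, continuous u} /\ {for p, continuous v}.
Proof. by case=> a [b H] /H[_ _ /is_diff_cont ? /is_diff_cont]. Qed.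

Lemma hol_sub D D' u v : D' `<=` D -> hol D u v -> hol D' u v.
Proof. by move=> s [a [b H]]; exists a, b => p /s/H. Qed.

Lemma hol_cst D (s t : R) : hol D (fun=> s) (fun=> t).
Proof.
exists (fun=> 0), (fun=> 0) => p _; split; try exact: cst_continuous.
- by apply: (is_diff_eq (is_diff_cst s p)); apply/funext => h; rewrite /lin2 oppr0 !mul0r addr0.
- by apply: (is_diff_eq (is_diff_cst t p)); apply/funext => h; rewrite /lin2 !mul0r addr0.
Qed.

Lemma hol_id D : hol D fst snd.
Proof.
exists (fun=> 1), (fun=> 0) => p _; split; try exact: cst_continuous.
- apply/is_diff_lin2P => e e0; near=> h.
  rewrite (_ : _ - _ - _ = 0) ?normr0 ?mulr_ge0 ?(ltW e0) //.
  by rewrite /lin2 /=; ring.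
- apply/is_diff_lin2P => e e0; near=> h.
  rewrite (_ : _ - _ - _ = 0) ?normr0 ?mulr_ge0 ?(ltW e0) //.
  by rewrite /lin2 /=; ring.
Unshelve. all: by end_near. Qed.

Lemma holD D u v u' v' : hol D u v -> hol D u' v' ->
  hol D (fun z => u z + u' z) (fun z => v z + v' z).
Proof.
move=> [a [b H]] [a' [b' H']].
exists (fun z => a z + a' z), (fun z => b z + b' z) => p Dp.
have [ca cb du dv] := H p Dp; have [ca' cb' du' dv'] := H' p Dp; split.
- by apply: cvgD.
- by apply: cvgD.
- apply: (is_diff_eq (is_diffD du du')); apply/funext => h.
  by rewrite !fctE /lin2; ring.
- apply: (is_diff_eq (is_diffD dv dv')); apply/funext => h.
  by rewrite !fctE /lin2; ring.
Qed.

Lemma holM D u v u' v' : hol D u v -> hol D u' v' ->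
  hol D (fun z => u z * u' z - v z * v' z) (fun z => u z * v' z + v z * u' z).
Proof.
move=> [a [b H]] [a' [b' H']].
exists (fun z => u z * a' z + u' z * a z - (v z * b' z + v' z * b z)),
  (fun z => u z * b' z + u' z * b z + (v z * a' z + v' z * a z)) => p Dp.
have [ca cb du dv] := H p Dp; have [ca' cb' du' dv'] := H' p Dp.
have cu := is_diff_cont du; have cv := is_diff_cont dv.
have cu' := is_diff_cont du'; have cv' := is_diff_cont dv'; split.
- by apply: cvgB; apply: cvgD; apply: cvgM.
- by apply: cvgD; apply: cvgD; apply: cvgM.
- apply: (is_diff_eq (is_diffB (is_diffM du du') (is_diffM dv dv'))).
  by apply/funext => h; rewrite !fctE /lin2 /GRing.scale /=; ring.
- apply: (is_diff_eq (is_diffD (is_diffM du dv') (is_diffM dv du'))).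
  by apply/funext => h; rewrite !fctE /lin2 /GRing.scale /=; ring.
Qed.

Lemma is_diffV u du p : u p != 0 -> is_diff p u du ->
  is_diff p (fun z => (u z)^-1) (fun h => - (u p) ^- 2 * du h).
Proof.
move=> u0 [dfu E]; split; first exact: differentiableV.
by rewrite diffV // E; apply/funext => h.
Qed.

Lemma holV D u v : (forall p, D p -> u p ^+ 2 + v p ^+ 2 != 0) -> hol D u v ->
  hol D (fun z => u z / (u z ^+ 2 + v z ^+ 2))
        (fun z => - v z / (u z ^+ 2 + v z ^+ 2)).
Proof.
move=> n0 [a [b H]].
pose n z := u z ^+ 2 + v z ^+ 2.
(* (1/h)' = - h' / h^2 = - h' conj(h)^2 / |h|^4 *)
exists (fun z => - (a z * (u z ^+ 2 - v z ^+ 2) + 2 * b z * u z * v z) * (n z)^-1 ^+ 2),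
  (fun z => - (b z * (u z ^+ 2 - v z ^+ 2) - 2 * a z * u z * v z) * (n z)^-1 ^+ 2) => p Dp.
have [ca cb du dv] := H p Dp.
have cu := is_diff_cont du; have cv := is_diff_cont dv.
have np := n0 p Dp.
have cn : {for p, continuous (fun z => (n z)^-1)}.
  by apply: cvgV => //; rewrite /n; apply: cvgD; apply: cvgM.
have dn : is_diff p (u * u + v * v) (lin2 (2 * (u p * a p + v p * b p)) (2 * (v p * a p - u p * b p))).
  apply: (is_diff_eq (is_diffD (is_diffM du du) (is_diffM dv dv))).
  by apply/funext => h; rewrite !fctE /lin2 /GRing.scale /=; ring.
have n0' : (u * u + v * v) p != 0 by rewrite !fctE -!expr2.
have dV := is_diffV n0' dn.
split.
- apply: cvgM; last by apply: cvgM.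
  apply: cvgN; apply: cvgD; first by apply: cvgM => //; apply: cvgB; apply: cvgM.
  by repeat (apply: cvgM => //); exact: cvg_cst.
- apply: cvgM; last by apply: cvgM.
  apply: cvgN; apply: cvgB; first by apply: cvgM => //; apply: cvgB; apply: cvgM.
  by repeat (apply: cvgM => //); exact: cvg_cst.
- apply: (is_diff_eq (is_diffM du dV)).
  apply/funext => h; rewrite !fctE /lin2 /GRing.scale /= -/(n p).
  by rewrite /n in np *; field.
- apply: (is_diff_eq (is_diffM (is_diffN dv) dV)).
  apply/funext => h; rewrite !fctE /lin2 /GRing.scale /= -/(n p).
  by rewrite /n in np *; field.
Qed.
End Holomorphic.

(** * Mean value property on circles *)

Section MeanValue.
Variable R : realType.
Implicit Types (u v a b : R * R -> R) (p q z : R * R) (D : set (R * R)).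

(** Schwarz reflection: for [h = u + i v] the new pair is the conjugate of [h] at the conjugate
    point. *)
Lemma hol_conj D u v : hol D u v ->
  hol [set z | D (z.1, - z.2)] (fun z => u (z.1, - z.2)) (fun z => - v (z.1, - z.2)).
Proof.
move=> [a [b H]].
have cj (c : R * R -> R) p : {for (p.1, - p.2), continuous c} ->
    {for p, continuous (fun z => c (z.1, - z.2))}.
  move=> cc; apply: (@continuous_comp _ _ _ (fun z : R * R => (z.1, - z.2))) => //.
  have cN : {for p, continuous (fun z : R * R => - z.2)}.
    by apply: cvgN; exact: cvg_snd.
  exact: (cvg_pair (@cvg_fst _ _ _ _ _) cN).
have dj (c : R * R -> R) (s t : R) p : is_diff (p.1, - p.2) c (lin2 s t) ->
    is_diff p (fun z => c (z.1, - z.2)) (lin2 s (- t)).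
  move=> /is_diff_lin2P dc; apply/is_diff_lin2P => e e0.
  have /near_prodP[d d0 {}dc] := dc e e0; apply/near_prodP; exists d => // h /= h1 h2.
  have := dc (h.1, - h.2).
  rewrite /= !subr0 in h1 h2 *; rewrite normrN => /(_ h1 h2).
  rewrite !prod_normE /= normrN.
  rewrite (_ : lin2 s (- t) h = lin2 s t (h.1, - h.2)); last by rewrite /lin2 /=; ring.
  by rewrite (_ : (h.1, - h.2) + _ = (h.1 + p.1, - (h.2 + p.2))) // opprD.
exists (fun z => a (z.1, - z.2)), (fun z => - b (z.1, - z.2)) => p /= Dp.
have [ca cb du dv] := H _ Dp; split.
- exact: cj.
- by apply: cvgN; exact: cj.
- exact: dj.
- apply: (is_diff_eq (is_diffN (dj _ _ _ _ dv))); apply/funext => h.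
  by rewrite fctE /lin2; ring.
Qed.

Lemma is_derive_curve u (s t : R) (x y : R -> R) (w x' y' : R) :
  is_derive w 1 x x' -> is_derive w 1 y y' -> is_diff (x w, y w) u (lin2 s t) ->
  is_derive w 1 (fun k => u (x k, y k)) (s * x' + t * y').
Proof.
have D1 (f : R -> R) f' : is_derive w 1 f f' -> is_diff w f ( *%R^~ f').
  move=> [df E]; have dF : differentiable f w by exact/derivable1_diffP.
  by split => //; rewrite diff1E // derive1E E.
move=> /D1 dx /D1 dy du.
have := @is_diff_comp _ _ _ _ _ _ _ _ _ (is_diff_pair dx dy) du.
move=> [df E].
split; first exact: diff_derivable.
rewrite deriveE // E /= /lin2 /=; ring.
Qed.

Variables (D : set (R * R)) (u v a b : R * R -> R).
Hypothesis H : forall p, D p ->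
  [/\ {for p, continuous a}, {for p, continuous b},
      is_diff p u (lin2 (a p) (- b p)) & is_diff p v (lin2 (b p) (a p))].
Variables (p : R * R) (r : R).
Hypothesis r0 : 0 < r.

Definition polar (t w : R) : R * R := (p.1 + t * cos w, p.2 + t * sin w).
Hypothesis Dp : forall t w : R, 0 <= t <= r -> D (polar t w).

(** For [h = u + i v] this is the real part of [h'(z) e^(i w)] at [z = polar t w]. By the polar
    Cauchy-Riemann equations it is the radial derivative of [u] and, times [t], the angular
    derivative of [v]. *)
Let g (t w : R) := a (polar t w) * cos w - b (polar t w) * sin w.

Lemma polar_radial (t w : R) : 0 <= t <= r -> is_derive t 1 (fun t => u (polar t w)) (g t w).
Proof.
move=> tr; have [_ _ du _] := H (Dp w tr).
have := @is_derive_curve u _ _ (fun t => p.1 + t * cos w) (fun t => p.2 + t * sin w) t (cos w) (sin w) _ _ du.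
rewrite /g mulNr; apply.
  by apply: is_derive_eq; rewrite /GRing.scale /=; ring.
by apply: is_derive_eq; rewrite /GRing.scale /=; ring.
Qed.

Lemma polar_angular (t w : R) : 0 <= t <= r -> is_derive w 1 (fun w => v (polar t w)) (t * g t w).
Proof.
move=> tr; have [_ _ _ dv] := H (Dp w tr).
have := @is_derive_curve v _ _ (fun w => p.1 + t * cos w) (fun w => p.2 + t * sin w) w (t * - sin w) (t * cos w) _ _ dv.
have -> : t * g t w = b (polar t w) * (t * - sin w) + a (polar t w) * (t * cos w).
  by rewrite /g; ring.
apply.
  by apply: is_derive_eq; rewrite /GRing.scale /=; ring.
by apply: is_derive_eq; rewrite /GRing.scale /=; ring.
Qed.

(** Compactness of the rectangle of radii and angles makes continuity in the angle uniform in the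
    radius too; [w'] may leave the interval. *)
Lemma polar_unif (e : R) : 0 < e -> exists2 d : R, 0 < d &
  forall t w w' : R, 0 <= t <= r -> 0 <= w <= 2 * pi -> `|w - w'| < d -> `|g t w - g t w'| < e.
Proof.
move=> e0.
have K : compact (`[0, r]%classic `*` `[0, 2 * pi : R]%classic) by apply: compact_setX; exact: segment_compact.
move/compact_near_coveringP : K => /(_ _ (0^'+)
  (fun d x => forall w', `|x.2 - w'| < d -> `|g x.1 x.2 - g x.1 w'| < e) _).
case.
  move=> [t w] [/= tr _]; rewrite in_itv /= in tr.
  have [ca cb _ _] := H (Dp w tr).
  have cg : {for (t, w), continuous (fun x => g x.1 x.2)}.
    have cc : {for (t, w), continuous (fun x : R * R => cos x.2)}.
      by apply: (@continuous_comp _ _ _ snd) => /=; [exact: cvg_snd|exact: continuous_cos].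
    have cs : {for (t, w), continuous (fun x : R * R => sin x.2)}.
      by apply: (@continuous_comp _ _ _ snd) => /=; [exact: cvg_snd|exact: continuous_sin].
    have c1 : {for (t, w), continuous (fun x : R * R => p.1 + x.1 * cos x.2)}.
      apply: cvgD; first exact: cvg_cst.
      by apply: cvgM => //; exact: cvg_fst.
    have c2 : {for (t, w), continuous (fun x : R * R => p.2 + x.1 * sin x.2)}.
      apply: cvgD; first exact: cvg_cst.
      by apply: cvgM => //; exact: cvg_fst.
    have cp : {for (t, w), continuous (fun x => polar x.1 x.2)} by exact: (cvg_pair c1 c2).
    apply: cvgB; apply: cvgM => //.
      exact: (@continuous_comp _ _ _ (fun x => polar x.1 x.2) a).
    exact: (@continuous_comp _ _ _ (fun x => polar x.1 x.2) b).
  have e20 : 0 < e / 2 by rewrite divr_gt0.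
  move/cvgrPdist_lt/(_ _ e20)/near_prodP: cg => [d d0 cg].
  exists ([set x : R * R | `|x.1 - t| < d / 2 /\ `|x.2 - w| < d / 2], [set k | k < d / 2]).
    split => /=.
      by apply/near_prodP; exists (d / 2); [rewrite divr_gt0|].
    by apply: nbhs_right_lt; rewrite divr_gt0.
  move=> [[t' w'] k] [/= [t't w'w] kd] w'' w''k.
  have A : `|g t w - g t' w'| < e / 2.
    by apply: (cg (t', w')) => /=; [apply: lt_trans t't _|apply: lt_trans w'w _]; lra.
  have B : `|g t w - g t' w''| < e / 2.
    apply: (cg (t', w'')) => /=; first by apply: lt_trans t't _; lra.
    rewrite (_ : w'' - w = (w' - w) - (w' - w'')); last by ring.
    apply: le_lt_trans (ler_normB _ _) _.
    have := lt_trans w''k kd; lra.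
  rewrite (_ : g t' w' - g t' w'' = (g t w - g t' w'') - (g t w - g t' w')); last by ring.
  by apply: le_lt_trans (ler_normB _ _) _; lra.
move=> d /= d0 Hd.
exists (d / 2); first by rewrite divr_gt0.
move=> t w w' tr wr; apply: (Hd (d / 2) _ _ (t, w)).
- by rewrite /= sub0r normrN gtr0_norm ?divr_gt0 //; lra.
- by rewrite divr_gt0.
- by split; rewrite /= in_itv.
Qed.

(* The averages of u over the N-th roots of unity of radius t have t-derivative
   a Riemann sum of the theta-derivative of v, whose integral over the circle
   is 0. *)
Lemma circle_mean_ge (e : R) : 0 < e -> exists w, u p - e <= u (polar r w).
Proof.
move=> e0.
(* This tolerance becomes [e] after multiplication by [r], the length of the radial interval in the
   mean value theorem. *)
have er0 : 0 < e / r by rewrite divr_gt0.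
have [d d0 Hd] := polar_unif er0.
have pi0 := pi_gt0 R.
pose N := (Num.bound (2 * pi / d)).+1.
have N0 : 0 < N%:R :> R by rewrite ltr0n.
pose h : R := 2 * pi / N%:R.
have h0 : 0 < h by rewrite /h divr_gt0 // mulr_gt0.
have hd : h < d.
  rewrite /h ltr_pdivrMr // -ltr_pdivrMl // [d^-1 * _]mulrC /N.
  have : 0 <= 2 * pi / d by rewrite divr_ge0 ?(ltW d0) // mulr_ge0 ?(ltW pi0).
  by move/archi_boundP/lt_le_trans; apply; rewrite ler_nat.
have Nh : N%:R * h = 2 * pi by rewrite /h mulrC divfK // gt_eqF.
apply: contrapT => /forallNP bad.
have {}bad w : u (polar r w) < u p - e by rewrite ltNge; apply/negP/bad.
have th k : (k < N)%N -> 0 <= k%:R * h /\ k.+1%:R * h <= 2 * pi.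
  move=> kN; rewrite mulr_ge0 ?(ltW h0) //; split=> //.
  by rewrite -Nh ler_wpM2r ?(ltW h0) // ler_nat.
pose P t := \sum_(i < N) u (polar t (i%:R * h)).
have dP t : 0 <= t <= r -> is_derive t 1 P (\sum_(i < N) g t (i%:R * h)).
  move=> tr.
  have := @is_derive_sum _ _ _ N (fun i t => u (polar t (i%:R * h))) t 1
    (fun i => g t (i%:R * h)) (fun i => polar_radial _ tr).
  rewrite (_ : \sum_i _ = P) //.
  by apply/funext => k; rewrite /P fct_sumE.
have [t||c] := @MVT _ P (fun t => \sum_(i < N) g t (i%:R * h)) 0 r r0.
- by rewrite in_itv /= => /andP[t0 tr]; apply: dP; rewrite !ltW.
- apply: derivable_within_continuous => t; rewrite in_itv /= => tr.
  by case: (dP t tr).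
rewrite in_itv /= subr0 => /andP[c0 cr] E.
have cr' : 0 <= c <= r by rewrite !ltW.
(* In each arc the mean value theorem gives an angle [x] at which [c * g c x * h] is exactly the
   increment of [v]. *)
have xi (k : 'I_N) : {x : R | 0 <= x <= 2 * pi /\ `|k%:R * h - x| < d &
    v (polar c (k.+1%:R * h)) - v (polar c (k%:R * h)) = c * g c x * h}.
  apply: cid2; have [k1 k2] := th _ (ltn_ord k).
  have kk : k%:R * h < k.+1%:R * h by rewrite ltr_pM2r // ltr_nat.
  have [t _||x] := @MVT _ (fun w => v (polar c w)) (fun w => c * g c w) _ _ kk.
  - exact: polar_angular.
  - apply: derivable_within_continuous => t _.
    by case: (polar_angular t cr').
  rewrite in_itv /= => /andP[x1 x2] Ex; exists x.
    split; first by rewrite (le_trans k1 (ltW x1)) (le_trans (ltW x2) k2).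
    rewrite distrC gtr0_norm ?subr_gt0 //; apply: lt_trans hd.
    by move: x2; rewrite -natr1 mulrDl mul1r ltrBlDl.
  by rewrite Ex -mulrBl -natr1 addrAC subrr add0r mul1r.
pose x k := s2val (xi k).
(* The increments of [v] telescope to 0 around the closed circle, and [c * h] is nonzero. *)
have S0 : \sum_(k < N) g c (x k) = 0.
  have : \sum_(k < N) (v (polar c (k.+1%:R * h)) - v (polar c (k%:R * h))) = 0.
    rewrite -(big_mkord xpredT (fun k => v (polar c (k.+1%:R * h)) - v (polar c (k%:R * h)))).
    rewrite (telescope_sumr (fun k => v (polar c (k%:R * h)))) // Nh mul0r.
    by rewrite /polar [2 * pi]mulr_natl cos2pi sin2pi cos0 sin0 subrr.
  rewrite (eq_bigr (fun k => c * h * g c (x k))); last first.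
    by move=> k _; rewrite /x; case: (xi k) => y /= _ ->; ring.
  rewrite -mulr_sumr => /eqP; rewrite (mulf_eq0 (c * h)) (mulf_eq0 c) (gt_eqF c0) (gt_eqF h0).
  by move/eqP.
have S1 : - (N%:R * (e / r)) <= \sum_(k < N) g c (k%:R * h).
  suff : - (N%:R * (e / r)) <= \sum_(k < N) (g c (k%:R * h) - g c (x k)).
    by rewrite sumrB S0 subr0.
  rewrite -[N in N%:R]card_ord mulr_natl -sumr_const -sumrN.
  apply: ler_sum => k _; have [k1 k2] := th _ (ltn_ord k).
  have : `|g c (k%:R * h) - g c (x k)| < e / r.
    rewrite /x; case: (xi k) => y /= [y1 y2] _; apply: Hd => //.
    rewrite k1 /=; apply: le_trans k2.
    by rewrite ler_wpM2r ?(ltW h0) // ler_nat.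
  by rewrite ltr_norml => /andP[/ltW].
have P0 : P 0 = N%:R * u p.
  rewrite /P (eq_bigr (fun=> u p)); first by rewrite sumr_const card_ord mulr_natl.
  by move=> i _; rewrite /polar !mul0r !addr0 -surjective_pairing.
have Pr : P r < N%:R * (u p - e).
  rewrite -[N in N%:R]card_ord mulr_natl -sumr_const; apply: ltr_sum => //.
  by apply/hasP; exists ord0; rewrite // mem_index_enum.
(* So [P r - P 0] is at least [- N e], while [bad] puts [P r] strictly below [P 0 - N e]. *)
have : - (N%:R * (e / r)) * r <= (\sum_(k < N) g c (k%:R * h)) * r by rewrite ler_wpM2r // ltW.
rewrite -E P0.
rewrite mulNr -mulrA divfK ?gt_eqF //.
by move: Pr; rewrite mulrBr; lra.
Qed.
End MeanValue.

(** * Maximum principle and three-circles estimates *)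

Section MaximumPrinciple.
Variable R : realType.
Implicit Types (u v : R * R -> R) (p q z w : R * R) (D K : set (R * R)).

(** Polynomial, unlike the maximum norm of the product. Radii measured by it are squared: a factor
    1/4 halves a disc, and the triangle inequality costs a factor 2. *)
Definition dist2 z q : R := (z.1 - q.1) ^+ 2 + (z.2 - q.2) ^+ 2.

Lemma dist2_ge0 z q : 0 <= dist2 z q.
Proof. by rewrite addr_ge0 ?sqr_ge0. Qed.

Lemma dist2C z q : dist2 z q = dist2 q z.
Proof. by rewrite /dist2; ring. Qed.

Lemma dist2_triangle z p q : dist2 z p <= 2 * dist2 z q + 2 * dist2 q p.
Proof.
rewrite -subr_ge0 /dist2.
set t := (X in 0 <= X).
have -> : t = (z.1 - q.1 - (q.1 - p.1)) ^+ 2 + (z.2 - q.2 - (q.2 - p.2)) ^+ 2.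
  by rewrite /t; ring.
by rewrite addr_ge0 ?sqr_ge0.
Qed.

Lemma continuous_dist2 q : continuous (fun z => dist2 z q).
Proof.
have c1 p : {for p, continuous (fun z : R * R => z.1 - q.1)}.
  by apply: cvgB; [exact: cvg_fst|exact: cvg_cst].
have c2 p : {for p, continuous (fun z : R * R => z.2 - q.2)}.
  by apply: cvgB; [exact: cvg_snd|exact: cvg_cst].
by move=> p; rewrite /dist2; apply: cvgD; apply: cvgM; [exact: c1|exact: c1|exact: c2|exact: c2].
Qed.

Lemma near_dist2P (P : R * R -> Prop) p :
  (\forall z \near p, P z) <-> exists2 r : R, 0 < r & forall z, dist2 z p <= r -> P z.
Proof.
split=> [/near_prodP[d d0 H]|[r r0 H]].
  exists ((d / 2) ^+ 2); first by rewrite exprn_gt0 ?divr_gt0.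
  have lt_d (x y : R) : x ^+ 2 + y ^+ 2 <= (d / 2) ^+ 2 -> `|x| < d.
    move=> xy; apply: (@le_lt_trans _ _ (d / 2)); last by lra.
    rewrite -(@ler_pXn2r _ 2) ?nnegrE ?divr_ge0 ?(ltW d0) //.
    by rewrite real_normK ?num_real //; apply: le_trans xy; rewrite lerDl sqr_ge0.
  move=> z zp; apply: H; first exact: lt_d zp.
  by apply: lt_d; rewrite addrC; exact: zp.
have : \forall z \near p, dist2 z p < r.
  have := @continuous_dist2 p p; rewrite /continuous_at {2}/dist2 !subrr expr0n addr0.
  move=> /cvgrPdist_lt/(_ r r0); apply: filterS => z.
  by rewrite sub0r normrN ger0_norm ?dist2_ge0.
by apply: filterS => z /ltW/H.
Qed.

Lemma near_dist2_lt p q (r : R) : dist2 p q < r -> \forall z \near p, dist2 z q < r.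
Proof.
move=> pr; have := @continuous_dist2 q p => /cvgr_lt; exact.
Qed.

Lemma near_dist2_gt p q (r : R) : r < dist2 p q -> \forall z \near p, r < dist2 z q.
Proof.
move=> pr; have := @continuous_dist2 q p => /cvgr_gt; exact.
Qed.

Lemma hol_circle D u v p (r e : R) : hol D u v -> 0 < r ->
  (forall z, dist2 z p <= r -> D z) -> 0 < e ->
  exists2 z, dist2 z p = r & u p - e <= u z.
Proof.
move=> [a [b H]] r0 rD e0.
have s0 : 0 < Num.sqrt r by rewrite sqrtr_gt0.
have dE (t th : R) : dist2 (polar p t th) p = t ^+ 2.
  rewrite /dist2 /polar /= -[RHS]mulr1 -(cos2Dsin2 th); ring.
have [t w /andP[t0 tr]|w uw] := @circle_mean_ge _ _ _ _ _ _ H p _ s0 _ e e0.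
  apply: rD; rewrite dE -(@sqr_sqrtr _ r) ?(ltW r0) //.
  by rewrite ler_pXn2r // nnegrE ?sqrtr_ge0.
by exists (polar p (Num.sqrt r) w); rewrite // dE sqr_sqrtr // ltW.
Qed.

(** If the bound failed, adding a small multiple of [|z|^2] to [|h|^2] would give a strictly
    subharmonic function whose maximum over [K] is attained where [|h|^2 > C], hence at an interior
    point. *)
Lemma hol_max D K u v (C : R) : hol D u v -> compact K -> K `<=` D ->
  (forall z, K z -> u z ^+ 2 + v z ^+ 2 <= C \/ \forall w \near z, K w) ->
  forall z, K z -> u z ^+ 2 + v z ^+ 2 <= C.
Proof.
move=> huv cK KD HK z1 Kz1; rewrite leNgt; apply/negP => Cz1.
have K0 : K !=set0 by exists z1.
have cf (f : R * R -> R) : (forall z, K z -> {for z, continuous f}) -> {within K, continuous f}.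
  by move=> h; apply: continuous_in_subspaceT => z /set_mem; exact: h.
pose n z := u z ^+ 2 + v z ^+ 2.
pose s z := dist2 z 0.
have cn z : K z -> {for z, continuous n}.
  by move=> /KD Dz; have [cu cv] := hol_cont huv Dz; apply: cvgD; apply: cvgM.
have cs z : K z -> {for z, continuous s} by move=> _; exact: continuous_dist2.
have [zm zmK zmM] := compact_EVT_max K0 cK (cf _ cs).
have s_ge0 z : 0 <= s z by exact: dist2_ge0.
pose Q := s zm + 1.
have Q0 : 0 < Q by rewrite ltr_wpDl.
(* With this choice [e * s z] is on [K] at most half the excess of [n z1] over [C]. *)
pose e := (n z1 - C) / Q / 2.
have e0 : 0 < e by rewrite !divr_gt0 // subr_gt0.
have ceq : {within K, continuous (fun z => n z + e * s z)}.
  apply: cf => z Kz; apply: cvgD; first exact: cn.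
  by apply: cvgM; [exact: cvg_cst|exact: cs].
have [p /set_mem pK pM] := compact_EVT_max K0 cK ceq.
have {}pM z : K z -> n z + e * s z <= n p + e * s p by move=> Kz; apply/pM/mem_set.
have eQ : e * Q = (n z1 - C) / 2.
  by rewrite /e mulrAC divfK ?gt_eqF.
have Cp : C < n p.
  have h1 := pM z1 Kz1.
  have h2 : e * s p <= e * Q.
    apply: ler_wpM2l; first exact: ltW.
    by apply: (le_trans (zmM p (mem_set pK))); rewrite lerDl.
  have h3 : 0 <= e * s z1 by rewrite mulr_ge0 // ltW.
  rewrite eQ in h2; rewrite -/(n z1) in Cz1; lra.
case: (HK p pK) => [|/near_dist2P[r r0 rK]]; first by rewrite leNgt -/(n p) Cp.
(* |h|^2 + e |z|^2 minus its tangent at p is at least e r on the circle, while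
   the tangent part is the real part of a holomorphic function. *)
have hk := holD (holM (hol_cst D (2 * u p) (- (2 * v p))) huv)
  (holM (hol_cst D (2 * e * p.1) (- (2 * e * p.2))) (hol_id D)).
(* The tangent part loses at most [e r / 2] at the chosen point of the circle, less than the gain
   [e r] of the rest. *)
have er0 : 0 < e * r / 2 by rewrite divr_gt0 // mulr_gt0.
have [z zr kz] := hol_circle hk r0 (fun z zr => KD z (rK z zr)) er0.
have := pM z (rK z _); rewrite zr => /(_ (lexx _)).
have h1 : 0 <= (u z - u p) ^+ 2 + (v z - v p) ^+ 2 by rewrite addr_ge0 ?sqr_ge0.
have h2 : e * dist2 z p = e * r by rewrite zr.
rewrite /n /s /dist2 /=; rewrite /dist2 in h2.
move: kz h1 h2 er0; rewrite /=; nra.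
Qed.

Lemma annulus_compact q (r1 r2 : R) : compact [set z | r1 <= dist2 z q <= r2].
Proof.
have bc : compact (`[q.1 - (r2 + 1), q.1 + (r2 + 1)]%classic `*` `[q.2 - (r2 + 1), q.2 + (r2 + 1)]%classic).
  by apply: compact_setX; exact: segment_compact.
apply: (subclosed_compact _ bc).
  have -> : [set z | r1 <= dist2 z q <= r2] = (fun z => dist2 z q) @^-1` `[r1, r2]%classic.
    by apply/seteqP; split => z; rewrite /= in_itv.
  apply: closed_comp; last exact: interval_closed.
  by move=> z _; exact: continuous_dist2.
(* A bound free of square roots, from [2 |x| <= x^2 + 1]. *)
have sq_bound (x y : R) : x ^+ 2 + y ^+ 2 <= r2 -> - (r2 + 1) <= x <= r2 + 1.
  by move=> xy; apply/andP; split; nra.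
move=> z /= /andP[_ zr]; split; rewrite /= in_itv /=.
  have /andP[] := sq_bound _ _ zr; lra.
rewrite /dist2 addrC in zr; have /andP[] := sq_bound _ _ zr; lra.
Qed.

Lemma hol_normX D u v m : hol D u v -> exists u' v', hol D u' v' /\
  forall z, u' z ^+ 2 + v' z ^+ 2 = (u z ^+ 2 + v z ^+ 2) ^+ m.
Proof.
move=> huv; elim: m => [|m [u' [v' [h E]]]].
  by exists (fun=> 1), (fun=> 0); split=> [|z]; [exact: hol_cst|rewrite expr1n expr0n addr0 expr0].
exists (fun z => u z * u' z - v z * v' z), (fun z => u z * v' z + v z * u' z).
by split=> [|z]; [exact: holM|rewrite [RHS]exprS -E; ring].
Qed.

(** The maximum principle for [h^m / (z - q)^n] on the annulus; the hypotheses bound its squared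
    modulus by [C] on both boundary circles. *)
Lemma three_circles D u v q (r1 r2 C : R) m n : hol D u v -> 0 < r1 ->
  [set z | r1 <= dist2 z q <= r2] `<=` D ->
  (forall z, dist2 z q = r1 -> (u z ^+ 2 + v z ^+ 2) ^+ m <= C * r1 ^+ n) ->
  (forall z, dist2 z q = r2 -> (u z ^+ 2 + v z ^+ 2) ^+ m <= C * r2 ^+ n) ->
  forall z, r1 <= dist2 z q <= r2 ->
    (u z ^+ 2 + v z ^+ 2) ^+ m <= C * dist2 z q ^+ n.
Proof.
move=> huv r10 AD C1 C2.
pose A := [set z | r1 <= dist2 z q <= r2].
have Apos z : A z -> 0 < dist2 z q by move=> /= /andP[/(lt_le_trans r10)].
have [U [V [hUV E]]] := hol_normX m (hol_sub AD huv).
have hid := holD (hol_id A) (hol_cst A (- q.1) (- q.2)).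
have [|U' [V' [hUV' E']]] := hol_normX n (holV _ hid).
  by move=> z /Apos; rewrite /dist2 => /lt0r_neq0.
have N z : A z -> (U z * U' z - V z * V' z) ^+ 2 + (U z * V' z + V z * U' z) ^+ 2 =
    (u z ^+ 2 + v z ^+ 2) ^+ m / dist2 z q ^+ n.
  move=> /Apos zq0.
  transitivity ((U z ^+ 2 + V z ^+ 2) * (U' z ^+ 2 + V' z ^+ 2)); first by ring.
  rewrite E E' -exprVn; congr (_ * _ ^+ _); rewrite -/(dist2 z q).
  rewrite /dist2 in zq0 *; by field; rewrite gt_eqF.
have H := hol_max (holM hUV hUV') (@annulus_compact q r1 r2) (fun z Az => Az).
move=> z Az; rewrite -ler_pdivrMr ?exprn_gt0 ?Apos // -N //; apply: H => // w Aw.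
have [/eqP w1|w1] := boolP (dist2 w q == r1).
  by left; rewrite N // ler_pdivrMr ?exprn_gt0 ?Apos // w1; exact: C1.
have [/eqP w2|w2] := boolP (dist2 w q == r2).
  by left; rewrite N // ler_pdivrMr ?exprn_gt0 ?Apos // w2; exact: C2.
right; move: Aw => /= /andP[l1 l2].
have {w1}l1 : r1 < dist2 w q by rewrite lt_neqAle eq_sym w1.
have {w2}l2 : dist2 w q < r2 by rewrite lt_neqAle w2.
have h1 := near_dist2_gt l1; have h2 := near_dist2_lt l2.
by apply: filterS2 h1 h2 => x x1 x2; rewrite /= !ltW.
Qed.

Lemma exprn_small (x e : R) : 0 <= x < 1 -> 0 < e -> exists n, x ^+ n <= e.
Proof.
move=> /andP[x0 x1] e0.
have : (fun n => x ^+ n) @ \oo --> (0 : R) by apply: cvg_expr; rewrite ger0_norm.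
move=> /cvgrPdist_le/(_ e e0)[n _ Hn]; exists n.
have := Hn n (leqnn n); rewrite /= sub0r normrN ger0_norm //; exact: exprn_ge0.
Qed.

(** As [h] vanishes on a small circle, three circles give [|h|^2 <= M (dist2 z q / r2)^n] for every
    [n], with [M] a bound on the outer circle. The ratio is below 1, so [h z = 0]. *)
Lemma hol_disc_zero D u v q (s r : R) : hol D u v -> 0 < s ->
  (forall z, dist2 z q < r -> D z) ->
  (forall z, dist2 z q < s -> u z = 0 /\ v z = 0) ->
  forall z, dist2 z q < r -> u z = 0 /\ v z = 0.
Proof.
move=> huv s0 rD sZ z zr.
have [|sz] := ltP (dist2 z q) s; first exact: sZ.
have d0 : 0 < dist2 z q by exact: lt_le_trans sz.
pose r2 := (dist2 z q + r) / 2.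
have zr2 : dist2 z q < r2 by rewrite /r2; lra.
have r2r : r2 < r by rewrite /r2; lra.
have r20 : 0 < r2 by apply: lt_trans zr2.
pose A := [set z | s / 2 <= dist2 z q <= r2].
have AD : A `<=` D by move=> w /= /andP[_ wr]; apply: rD; exact: le_lt_trans r2r.
have Az : A z by rewrite /A /=; apply/andP; split; [lra|exact: ltW].
have cA : {within A, continuous (fun z => u z ^+ 2 + v z ^+ 2)}.
  apply: continuous_in_subspaceT => w /set_mem /AD Dw.
  by have [cu cv] := hol_cont huv Dw; apply: cvgD; apply: cvgM.
have [zm _ zM] := compact_EVT_max (ex_intro _ z Az) (@annulus_compact q (s / 2) r2) cA.
pose M := u zm ^+ 2 + v zm ^+ 2 + 1.
have M0 : 0 < M by rewrite ltr_wpDl // addr_ge0 ?sqr_ge0.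
have key n : u z ^+ 2 + v z ^+ 2 <= M * (dist2 z q / r2) ^+ n.
  have := @three_circles D u v q (s / 2) r2 (M / r2 ^+ n) 1 n huv _ AD.
  rewrite divr_gt0 // => /(_ isT) => H.
  rewrite (_ : M * _ = M / r2 ^+ n * dist2 z q ^+ n); last by rewrite expr_div_n; ring.
  rewrite -[leLHS]expr1; apply: H => //.
    move=> w ws; have [|-> ->] := sZ w; first by rewrite ws; lra.
    rewrite expr0n addr0 expr1; apply: mulr_ge0; last by apply: exprn_ge0; lra.
    by apply: divr_ge0; [exact: ltW|apply/exprn_ge0/ltW].
  move=> w wr; rewrite expr1 divfK ?gt_eqF ?exprn_gt0 //.
  apply: le_trans (zM w _) _; last by rewrite /M lerDl.
  by apply/mem_set; rewrite /A /= wr lexx andbT; lra.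
have : u z ^+ 2 + v z ^+ 2 <= 0.
  rewrite leNgt; apply/negP => n0.
  have [||n Hn] := @exprn_small (dist2 z q / r2) ((u z ^+ 2 + v z ^+ 2) / M / 2).
  - by rewrite divr_ge0 ?dist2_ge0 ?(ltW r20) //= ltr_pdivrMr // mul1r.
  - by apply: divr_gt0 => //; exact: divr_gt0.
  have := key n; apply/negP; rewrite -ltNge.
  apply: (@le_lt_trans _ _ (M * ((u z ^+ 2 + v z ^+ 2) / M / 2))).
    by rewrite ler_pM2l.
  rewrite (_ : M * _ = (u z ^+ 2 + v z ^+ 2) / 2); first by lra.
  by field; rewrite gt_eqF.
move=> h; have : u z ^+ 2 + v z ^+ 2 == 0 by rewrite eq_le h addr_ge0 ?sqr_ge0.
by rewrite paddr_eq0 ?sqr_ge0 // !sqrf_eq0 => /andP[/eqP -> /eqP ->].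
Qed.

(** If [|h| < 1] at [q], then [|h|^2 <= m < 1] on a small disc about [q]. For large [a] the function
    [h^a / (z - q)] obeys on its boundary the bound valid on the circle of squared radius [r / 4],
    and three circles give [1 <= dist2 p q / (r / 4) < 1]. *)
Lemma hol_max_interior D u v p (r : R) : hol D u v ->
  (forall z, dist2 z p < r -> D z) ->
  (forall z, dist2 z p < r -> u z ^+ 2 + v z ^+ 2 <= 1) ->
  u p ^+ 2 + v p ^+ 2 = 1 ->
  forall q, dist2 q p < r / 4 -> u q ^+ 2 + v q ^+ 2 = 1.
Proof.
move=> huv rD le1 p1 q qr.
pose n z := u z ^+ 2 + v z ^+ 2; rewrite -/(n q).
have r0 : 0 < r by have := dist2_ge0 q p; lra.
have qr' : dist2 q p < r by lra.
apply/eqP; rewrite eq_le le1 //= leNgt; apply/negP => q1.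
pose m := (n q + 1) / 2.
have m1 : m < 1 by rewrite /m; lra.
have m0 : 0 <= m by rewrite /m divr_ge0 // !addr_ge0 ?sqr_ge0.
have cn : {for q, continuous n}.
  have [cu cv] := hol_cont huv (rD q qr').
  by apply: cvgD; apply: cvgM.
have qm : n q < m by rewrite /m; lra.
move/cvgr_lt/(_ _ qm)/near_dist2P: cn => [r1 r10 Hr1].
have pr1 : r1 <= dist2 p q.
  rewrite leNgt; apply/negP => /ltW/Hr1; rewrite /n p1 ltNge => /negP; apply; exact: ltW.
have pq : dist2 p q < r / 4 by rewrite dist2C.
have [||a Ha] := @exprn_small m (r1 / (r / 4)); first by rewrite m0.
  by apply: divr_gt0 => //; exact: divr_gt0.
(* Because [2 (r / 4) + 2 dist2 q p < r]. *)
have AD : [set z | r1 <= dist2 z q <= r / 4] `<=` [set z | dist2 z p < r].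
  move=> z /= /andP[_ zq]; apply: le_lt_trans (dist2_triangle z p q) _; lra.
have := @three_circles D u v q r1 (r / 4) (r / 4)^-1 a 1 huv r10.
move=> /(_ (fun z Az => rD z (AD z Az))) H.
have {}H := H _ _ p; rewrite pr1 (ltW pq) in H.
have : (u p ^+ 2 + v p ^+ 2) ^+ a <= (r / 4)^-1 * dist2 p q ^+ 1.
  apply: H => // z zq; rewrite expr1.
    rewrite mulrC; apply: le_trans Ha; rewrite lerXn2r ?nnegrE ?addr_ge0 ?sqr_ge0 //.
    by apply/ltW/Hr1; rewrite zq.
  rewrite mulVf; last by rewrite gt_eqF // divr_gt0.
  rewrite exprn_ile1 ?addr_ge0 ?sqr_ge0 //; apply/le1/AD.
  by rewrite /= zq lexx andbT (le_trans pr1) // ltW.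
rewrite p1 expr1n expr1 mulrC ler_pdivlMr ?mul1r ?divr_gt0 //.
by rewrite leNgt pq.
Qed.
End MaximumPrinciple.

(** * Identity principles: from an open set and from the real axis *)

Section Identity.
Variable R : realType.
Implicit Types (u v f : R * R -> R) (p q z w : R * R) (D : set (R * R)).

(** The interior of the zero set is relatively closed: near a limit point [z] there is a disc of
    zeros about some [q], and [hol_disc_zero] enlarges it until it contains [z]. *)
Lemma hol_identity D u v p : open D -> connected D -> hol D u v -> D p ->
  (\forall z \near p, u z = 0 /\ v z = 0) -> forall z, D z -> u z = 0 /\ v z = 0.
Proof.
move=> oD cD huv Dp p0.
pose Z := [set z | u z = 0 /\ v z = 0]^°.
have {p0}Zp : Z p by [].
suff E : D `&` Z = D by move=> z; rewrite -E => -[_] /nbhs_singleton.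
apply: cD; first by exists p.
  by exists Z => //; exact: open_interior.
exists (closure (D `&` Z)); first exact: closed_closure.
apply/seteqP; split => [z [Dz Zz]|z [Dz cz]].
  by split => //; apply: subset_closure.
split=> //.
have /near_dist2P[r r0 rD] : \forall w \near z, D w by exact: open_nbhs_nbhs.
(* For such [q] the disc of squared radius [r / 4] about [q] contains [z] and lies in [D], as
   [2 (r / 4) + 2 (r / 8) < r]. *)
have zr : nbhs z [set w | dist2 w z < r / 8].
  by apply/near_dist2P; exists (r / 16) => [|w] /=; [rewrite divr_gt0|lra].
have [q [[Dq /near_dist2P[s s0 qs]] /= qz]] := cz _ zr.
have H : forall w, dist2 w q < r / 4 -> u w = 0 /\ v w = 0.
  apply: (hol_disc_zero huv s0) => [w wq|w /ltW]; last exact: qs.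
  by apply: rD; apply: le_trans (dist2_triangle w z q) _; lra.
have : \forall w \near z, dist2 w q < r / 4 by apply: near_dist2_lt; rewrite dist2C; lra.
by apply: filterS => w; exact: H.
Qed.

Definition upper f z := if 0 <= z.2 then f z else 0.

Lemma near_snd_gt p (c : R) : c < p.2 -> \forall z \near p, c < z.2.
Proof.
move=> cp; have h : {for p, continuous (fun z : R * R => z.2)} by exact: cvg_snd.
by move/cvgr_gt/(_ _ cp): h.
Qed.

Lemma near_snd_lt p (c : R) : p.2 < c -> \forall z \near p, z.2 < c.
Proof.
move=> cp; have h : {for p, continuous (fun z : R * R => z.2)} by exact: cvg_snd.
by move/cvgr_lt/(_ _ cp): h.
Qed.

Lemma continuous_upper f p : {for p, continuous f} -> (p.2 = 0 -> f p = 0) ->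
  {for p, continuous (upper f)}.
Proof.
move=> cf f0; apply/cvgrPdist_lt => e e0.
move/cvgrPdist_lt/(_ e e0): cf => cf.
case: (ltgtP p.2 0) => p2.
- have h := near_snd_lt p2; apply: filterS h => z z2.
  by rewrite /upper !leNgt p2 z2 /= subrr normr0.
- have h := near_snd_gt p2; apply: filterS2 h cf => z z2.
  by rewrite /upper (ltW p2) (ltW z2).
- apply: filterS cf => z; rewrite /upper p2 lexx f0 //.
  by case: ifP => // _ _; rewrite subr0 normr0.
Qed.

Lemma is_diff_upper f (s t : R) p : is_diff p f (lin2 s t) ->
  (p.2 = 0 -> [/\ f p = 0, s = 0 & t = 0]) ->
  is_diff p (upper f) (lin2 (if 0 <= p.2 then s else 0) (if 0 <= p.2 then t else 0)).
Proof.
move=> /is_diff_lin2P df f0; apply/is_diff_lin2P => e e0.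
have {}df := df e e0.
have sh (P : R * R -> Prop) : (\forall z \near p, P z) -> \forall h \near (0 : R * R), P (h + p).
  by move=> Pp; rewrite (near_shift p); apply: filterS Pp => z /=; rewrite sub0r subrK.
case: (ltgtP p.2 0) => p2.
- have h := sh _ (near_snd_lt p2); apply: filterS h => h h2.
  have n1 : (0 <= p.2) = false by apply/negbTE; rewrite -ltNge.
  have n2 : (0 <= (h + p).2) = false by apply/negbTE; rewrite -ltNge.
  rewrite /upper n1 n2 /lin2 !mul0r addr0 !subrr normr0.
  by rewrite mulr_ge0 // ltW.
- have h := sh _ (near_snd_gt p2); apply: filterS2 h df => h h2.
  by rewrite /upper (ltW p2) (ltW h2).
- have [fp s0 t0] := f0 p2; rewrite s0 t0 ?if_same.
  apply: filterS df => h; rewrite s0 t0.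
  rewrite /upper p2 lexx fp; case: ifP => // _ _.
  by rewrite /lin2 !mul0r addr0 !subr0 normr0 mulr_ge0 // ltW.
Qed.

(** Testing the differential on [(k, 0)], along which [f] stays 0, gives [|s| <= e] for every
    [e]. *)
Lemma is_diff_real_axis f (s t r : R) p : is_diff p f (lin2 s t) -> 0 < r -> p.2 = 0 ->
  (forall z, dist2 z p < r -> z.2 = 0 -> f z = 0) -> s = 0.
Proof.
move=> df r0 p2 f0; apply/eqP; rewrite -normr_le0; apply/ler_addgt0Pr => e e0.
rewrite add0r.
move/is_diff_lin2P/(_ e e0)/near_prodP: df => [d d0 df].
have f0p : f p = 0 by apply: f0; rewrite // /dist2 !subrr expr0n addr0.
(* Small enough both for the estimate, valid below [d], and for the zeros, known within distance
   [sqrt r]. *)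
pose k := Num.min (d / 2) (Num.sqrt r / 2).
have k0 : 0 < k by rewrite lt_min !divr_gt0 // sqrtr_gt0.
have kd : k < d by rewrite gt_min; apply/orP; left; lra.
have kr : k ^+ 2 < r.
  have : k <= Num.sqrt r / 2 by rewrite ge_min lexx orbT.
  have := sqr_sqrtr (ltW r0); have := sqrtr_gt0 r; rewrite r0; nra.
have := df (k, 0); rewrite /= !subr0 normr0 gtr0_norm // => /(_ kd d0).
rewrite f0; first last.
- by rewrite /= add0r.
- by rewrite /dist2 /= addrK add0r subrr expr0n addr0.
rewrite f0p /lin2 /= mulr0 addr0 subrr sub0r normrN normrM (gtr0_norm k0).
by rewrite prod_normE /= normr0 (gtr0_norm k0) max_l ?(ltW k0) // ler_pM2r.
Qed.

(* The Cauchy-Riemann equations make both partial derivatives vanish on the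
   real axis, so the function stays holomorphic when it is replaced by 0 in the
   lower half-plane. *)
Lemma hol_real_axis D u v p (r : R) : hol D u v -> p.2 = 0 -> 0 < r ->
  (forall z, dist2 z p < r -> D z) ->
  (forall z, dist2 z p < r -> z.2 = 0 -> u z = 0 /\ v z = 0) ->
  forall z, dist2 z p < r / 16 -> 0 <= z.2 -> u z = 0 /\ v z = 0.
Proof.
move=> [a [b H]] p2 r0 rD axis z zp z2.
pose B := [set z | dist2 z p < r].
have hup : hol B (upper u) (upper v).
  exists (upper a), (upper b) => w Bw; have [ca cb du dv] := H w (rD w Bw).
  have ax : w.2 = 0 -> [/\ u w = 0, v w = 0, a w = 0 & b w = 0].
    move=> w2; have [u0 v0] := axis w Bw w2.
    have /near_dist2P[s s0 sB] := near_dist2_lt Bw.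
    split=> //.
      by apply: (is_diff_real_axis du s0 w2) => y /ltW/sB yB /(axis y yB)[].
    by apply: (is_diff_real_axis dv s0 w2) => y /ltW/sB yB /(axis y yB)[].
  split.
  - by apply: continuous_upper => // /ax[].
  - by apply: continuous_upper => // /ax[].
  - rewrite (_ : - upper b w = if 0 <= w.2 then - b w else 0); last first.
      by rewrite /upper; case: ifP; rewrite ?oppr0.
    by apply: is_diff_upper => // /ax[-> _ -> ->]; rewrite oppr0.
  - by apply: is_diff_upper => // /ax[_ -> -> ->].
(* The open disc of squared radius [c] about [q] lies below the real axis and touches it at [p], so
   the glued functions vanish on it; the disc of squared radius [4 c] about [q] still contains
   [z]. *)
pose c := r / 16; have c0 : 0 < c by rewrite divr_gt0.
pose q := (p.1, - Num.sqrt c).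
have pq : dist2 q p = c.
  by rewrite /dist2 /q /= p2 subrr subr0 sqrrN sqr_sqrtr ?(ltW c0) // expr0n add0r.
have qB w : dist2 w q < r / 4 -> B w.
  move=> wq; rewrite /B /=; apply: le_lt_trans (dist2_triangle w p q) _.
  rewrite pq /c; lra.
have q0 w : dist2 w q < c -> upper u w = 0 /\ upper v w = 0.
  move=> wq; have w2 : w.2 < 0.
    rewrite ltNge; apply/negP => w2.
    move: wq; rewrite /dist2 /q /= opprK.
    have := sqr_sqrtr (ltW c0); have := sqrtr_ge0 c.
    have := sqr_ge0 (w.1 - p.1); nra.
  by rewrite /upper leNgt w2.
have zq : dist2 z q < r / 4.
  apply: le_lt_trans (dist2_triangle z q p) _.
  rewrite [dist2 p q]dist2C pq /c; lra.
by have := hol_disc_zero hup c0 qB q0 zq; rewrite /upper z2.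
Qed.
End Identity.

(** * Inner product and imaginary units of the octonions *)

Section OctonionAlgebra.
Variable R : realType.
Implicit Types (I J c w x y : oct R).

(** Identities between octonions are tested against all functionals [oip c], which reduces them to
    real functions. *)
Definition oip x y : R :=
  x.1.1.1 * y.1.1.1 + x.1.1.2 * y.1.1.2 + (x.1.2.1 * y.1.2.1 + x.1.2.2 * y.1.2.2) +
  (x.2.1.1 * y.2.1.1 + x.2.1.2 * y.2.1.2 + (x.2.2.1 * y.2.2.1 + x.2.2.2 * y.2.2.2)).

Definition oct8 (a b c d a' b' c' d' : R) : oct R := (((a, b), (c, d)), ((a', b'), (c', d'))).

Lemma onormsqE x : onormsq x = oip x x.
Proof. by rewrite /onormsq /qnormsq /cnormsq /oip; ring. Qed.

Lemma onormsq_ge0 x : 0 <= onormsq x.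
Proof. by rewrite /onormsq /qnormsq /cnormsq !addr_ge0 ?sqr_ge0. Qed.

Lemma onormsq_eq0 x : onormsq x = 0 -> x = 0.
Proof.
case: x => [[[a b] [c d]] [[a' b'] [c' d']]]; rewrite /onormsq /qnormsq /cnormsq /=.
move/eqP; rewrite !paddr_eq0 ?addr_ge0 ?sqr_ge0 // !sqrf_eq0.
by move=> /andP[/andP[/andP[/eqP -> /eqP ->] /andP[/eqP -> /eqP ->]]
  /andP[/andP[/eqP -> /eqP ->] /andP[/eqP -> /eqP ->]]].
Qed.

Lemma sqr_re_le x : x.1.1.1 ^+ 2 <= onormsq x.
Proof.
by rewrite /onormsq /qnormsq /cnormsq -!addrA lerDl !addr_ge0 ?sqr_ge0.
Qed.

Lemma oipC x y : oip x y = oip y x.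
Proof. by rewrite /oip; ring. Qed.

Lemma oipDr c x y : oip c (x + y) = oip c x + oip c y.
Proof. by rewrite /oip /=; ring. Qed.

Lemma oipBr c x y : oip c (x - y) = oip c x - oip c y.
Proof. by rewrite /oip /=; ring. Qed.

Lemma oipZr c (k : R) x : oip c (k *: x) = k * oip c x.
Proof. by rewrite /oip /= /GRing.scale /=; ring. Qed.

Lemma oipNr c x : oip c (- x) = - oip c x.
Proof. by rewrite /oip /=; ring. Qed.

Lemma oip0 c : oip c 0 = 0.
Proof. by rewrite /oip /=; ring. Qed.

Lemma oip_inj x y : (forall c, oip c x = oip c y) -> x = y.
Proof.
move=> H; apply/subr0_eq/onormsq_eq0.
by rewrite onormsqE oipBr H subrr.
Qed.

Lemma continuous_oip c : continuous (oip c).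
Proof.
have fs (A B : topologicalType) (f : oct R -> A * B) x : {for x, continuous f} ->
    {for x, continuous (fun w => (f w).1)} /\ {for x, continuous (fun w => (f w).2)}.
  by move=> cf; split; [apply: cvg_comp cf _; exact: cvg_fst|apply: cvg_comp cf _; exact: cvg_snd].
move=> x.
have [c1 c2] := fs _ _ id x (fun A h => h).
have [c11 c12] := fs _ _ _ _ c1; have [c21 c22] := fs _ _ _ _ c2.
have [c111 c112] := fs _ _ _ _ c11; have [c121 c122] := fs _ _ _ _ c12.
have [c211 c212] := fs _ _ _ _ c21; have [c221 c222] := fs _ _ _ _ c22.
rewrite /oip; apply: cvgD; apply: cvgD; apply: cvgD; apply: cvgM => //; exact: cvg_cst.
Qed.

(** The norm is multiplicative, so [|I| = 1]; the real part of [I^2] is [2 Re(I)^2 - |I|^2], so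
    [Re(I) = 0]. *)
Lemma im_unitsP I : im_units I <-> I.1.1.1 = 0 /\ onormsq I = 1.
Proof.
split=> [h|].
  have nI : onormsq I = 1.
    have : onormsq (omul I I) = 1.
      by rewrite h /onormsq /qnormsq /cnormsq /= !oppr0 expr0n !addr0 sqrrN expr1n.
    rewrite onormsqM -expr2 => /eqP; rewrite sqrf_eq1 => /orP[/eqP //|/eqP n1].
    by have := onormsq_ge0 I; rewrite n1 oppr_ge0 ler10.
  split => //.
  have := congr1 (fun x : oct R => x.1.1.1) h.
  have : onormsq I + (omul I I).1.1.1 = 2 * I.1.1.1 ^+ 2.
    case: I {h nI} => [[[a b] [c d]] [[a' b'] [c' d']]].
    by rewrite /onormsq /qnormsq /cnormsq /=; ring.
  rewrite nI => + /= E; rewrite /= E subrr => /esym/eqP.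
  by rewrite mulf_eq0 pnatr_eq0 /= sqrf_eq0 => /eqP.
case: I => [[[a b] [c d]] [[a' b'] [c' d']]] /= [->].
rewrite /im_units /= => n1.
have -> : - oreal 1 = oreal (- onormsq ((((0 : R), b), (c, d)), ((a', b'), (c', d')))).
  by rewrite n1; congr (((_, _), (_, _)), ((_, _), (_, _))); rewrite oppr0.
by congr (((_, _), (_, _)), ((_, _), (_, _)));
  rewrite /onormsq /qnormsq /cnormsq /=; ring.
Qed.

Lemma im_units_i : im_units (oct8 0 1 0 0 0 0 0 0).
Proof.
by apply/im_unitsP; rewrite /onormsq /qnormsq /cnormsq /= !expr0n expr1n !addr0 add0r.
Qed.

Lemma im_unitsN I : im_units I -> im_units (- I).
Proof.
move=> /im_unitsP[i0 i1]; apply/im_unitsP; split; first by rewrite /= i0 oppr0.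
by rewrite -i1 /onormsq /qnormsq /cnormsq /= !sqrrN.
Qed.

(** The adjoint of left multiplication by [I] is left multiplication by [oconj I], here [- I]. *)
Lemma oip_imul I c x : im_units I -> oip c (omul I x) = - oip (omul I c) x.
Proof.
move=> /im_unitsP[]; case: I => [[[a b] [c0 d]] [[a' b'] [c' d']]] /= -> _.
case: c => [[[? ?] [? ?]] [[? ?] [? ?]]]; case: x => [[[? ?] [? ?]] [[? ?] [? ?]]].
by rewrite /oip /=; ring.
Qed.

Lemma omul0 x : omul x 0 = 0.
Proof. by congr (((_, _), (_, _)), ((_, _), (_, _))); rewrite /=; ring. Qed.

Lemma omulNr x y : omul x (- y) = - omul x y.
Proof. by congr (((_, _), (_, _)), ((_, _), (_, _))); rewrite /=; ring. Qed.

Lemma omulNN x y : omul (- x) (- y) = omul x y.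
Proof. by congr (((_, _), (_, _)), ((_, _), (_, _))); rewrite /=; ring. Qed.

Lemma scale_half x : 2^-1 *: (x + x) = x.
Proof.
apply: oip_inj => c; rewrite oipZr oipDr; move: (oip c x) => s; lra.
Qed.

(** Left alternativity [I (I x) = (I I) x], which survives the loss of associativity. *)
Lemma imulK I x : im_units I -> omul I (omul I x) = - x.
Proof.
move=> iI; apply: oip_inj => c; rewrite !oip_imul // opprK.
move: iI => /im_unitsP[]; case: I => [[[a b] [c0 d]] [[a' b'] [c' d']]] /= -> n1.
case: c => [[[? ?] [? ?]] [[? ?] [? ?]]]; case: x => [[[? ?] [? ?]] [[? ?] [? ?]]].
set l := LHS; set r := RHS.
(* Inserting the factor [|I|^2 = 1] turns the claim into a polynomial identity. *)
have -> : r = - onormsq ((((0 : R), b), (c0, d)), ((a', b'), (c', d'))) * - r by rewrite n1; ring.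
by rewrite /l /r /onormsq /qnormsq /cnormsq /oip /=; ring.
Qed.

(** Right multiplications by [y] and by [oconj y] are adjoint. The cross term thus becomes linear in
    [J] with a fixed coefficient, ready to be minimised over the units. *)
Lemma onormsq_slice J x y : im_units J ->
  onormsq (x + omul J y) = onormsq x + onormsq y + 2 * oip (omul x (oconj y)) J.
Proof.
move=> /im_unitsP[_ J1].
have E : oip (omul x (oconj y)) J = oip x (omul J y).
  case: J {J1} => [[[? ?] [? ?]] [[? ?] [? ?]]].
  case: x => [[[? ?] [? ?]] [[? ?] [? ?]]]; case: y => [[[? ?] [? ?]] [[? ?] [? ?]]].
  by rewrite /oip /=; ring.
have -> : onormsq (x + omul J y) = onormsq x + onormsq (omul J y) + 2 * oip x (omul J y).
  by rewrite !onormsqE oipDr ![oip (x + _) _]oipC !oipDr [oip (omul J y) x]oipC; ring.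
by rewrite onormsqM J1 mul1r E.
Qed.

(** The extremal case of Cauchy-Schwarz: [J] is minus the normalised imaginary part of [w], or any
    unit if [w] is real. *)
Lemma exists_im_unit_oip w : exists2 J, im_units J &
  oip w J = - Num.sqrt (onormsq w - w.1.1.1 ^+ 2).
Proof.
case: w => [[[a b] [c d]] [[a' b'] [c' d']]].
pose v := oct8 0 b c d a' b' c' d'.
have -> : onormsq (oct8 a b c d a' b' c' d') - (oct8 a b c d a' b' c' d').1.1.1 ^+ 2 = onormsq v.
  by rewrite /onormsq /qnormsq /cnormsq /=; ring.
have E J : J.1.1.1 = 0 -> oip (oct8 a b c d a' b' c' d') J = oip v J.
  by rewrite /oip /= => ->; ring.
have [v0|v0] := eqVneq (onormsq v) 0.
  exists (oct8 0 1 0 0 0 0 0 0).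
    exact: im_units_i.
  by rewrite E // v0 sqrtr0 oppr0 (onormsq_eq0 v0) /oip /=; ring.
have vp : 0 < onormsq v by rewrite lt_neqAle eq_sym v0 onormsq_ge0.
have sp : 0 < Num.sqrt (onormsq v) by rewrite sqrtr_gt0.
have sq := sqr_sqrtr (ltW vp).
have J0 : (- (Num.sqrt (onormsq v))^-1 *: v).1.1.1 = 0 by rewrite /= scaler0.
have J1 : onormsq (- (Num.sqrt (onormsq v))^-1 *: v) = 1.
  rewrite onormsqE oipZr oipC oipZr -onormsqE -[in X in _ * (_ * X)]sq.
  by field; rewrite gt_eqF.
exists (- (Num.sqrt (onormsq v))^-1 *: v); first exact/im_unitsP.
rewrite E // oipZr -onormsqE -[in X in _ * X]sq.
by field; rewrite gt_eqF.
Qed.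

(* The minimum over J of |x + J y|^2 is |x|^2 + |y|^2 - 2 |Im (x conj y)|, and
   its product with the maximum is |N|^2 for N = |x|^2 - |y|^2 + 2 i <x, y>. *)
Lemma slice_sphere_min x y (m : R) : 0 <= m ->
  (forall J, im_units J -> m <= onormsq (x + omul J y)) ->
  m ^+ 2 <= (onormsq x - onormsq y) ^+ 2 + (2 * oip x y) ^+ 2 /\
  (0 < m -> onormsq x - onormsq y = m -> oip x y = 0 -> y = 0).
Proof.
move=> m0 H; have [J iJ EJ] := exists_im_unit_oip (omul x (oconj y)).
have re : (omul x (oconj y)).1.1.1 = oip x y.
  case: x {H EJ} => [[[? ?] [? ?]] [[? ?] [? ?]]]; case: y => [[[? ?] [? ?]] [[? ?] [? ?]]].
  by rewrite /oip /=; ring.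
have Nxy : onormsq (omul x (oconj y)) = onormsq x * onormsq y.
  by rewrite onormsqM; congr (_ * _); rewrite /onormsq /qnormsq /cnormsq /=; ring.
have := H J iJ; rewrite onormsq_slice // EJ re Nxy.
set t := Num.sqrt _ => mt.
have t0 : 0 <= t by exact: sqrtr_ge0.
have CS : 0 <= onormsq x * onormsq y - oip x y ^+ 2.
  by rewrite subr_ge0 -Nxy -re; exact: sqr_re_le.
have t2 : t ^+ 2 = onormsq x * onormsq y - oip x y ^+ 2 by rewrite sqr_sqrtr.
have x0 := onormsq_ge0 x; have y0 := onormsq_ge0 y.
split.
  have -> : (onormsq x - onormsq y) ^+ 2 + (2 * oip x y) ^+ 2 =
    (onormsq x + onormsq y + 2 * - t) * (onormsq x + onormsq y + 2 * t).
    transitivity ((onormsq x + onormsq y) ^+ 2 - 4 * t ^+ 2); last by ring.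
    by rewrite t2; ring.
  rewrite expr2; apply: ler_pM => //; lra.
(* Now [t^2 = |x|^2 |y|^2], and [E] turns [mt] into [t <= |y|^2]. Hence
   [(|x|^2 - |y|^2) |y|^2 <= 0], that is [m |y|^2 <= 0]. *)
move=> mp E S0; apply: onormsq_eq0; apply/eqP; rewrite eq_le y0 andbT.
rewrite S0 expr0n subr0 in t2.
have ty : t <= onormsq y by lra.
have : t ^+ 2 <= onormsq y ^+ 2 by rewrite lerXn2r ?nnegrE.
rewrite t2 => h; nra.
Qed.
End OctonionAlgebra.

(** * Continuous linear functionals of vector-valued functions *)

Section LinearFunctional.
Variables (R : realType) (V : normedModType R) (l : V -> R).
Hypotheses (lB : forall x y, l (x - y) = l x - l y)
  (lZ : forall (k : R) x, l (k *: x) = k * l x) (cl : continuous l).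
Variables (D : set (R * R)) (F : R * R -> V).

Lemma is_derive_functional p v : derivable F p v ->
  is_derive p v (fun z => l (F z)) (l ('D_v F p)).
Proof.
move=> dF.
have E : (fun h : R => h^-1 *: (((fun z => l (F z)) \o shift p) (h *: v) - l (F p))) =
    (fun h => l (h^-1 *: ((F \o shift p) (h *: v) - F p))).
  by apply/funext => h /=; rewrite lZ lB.
have C : (fun h : R => h^-1 *: (((fun z => l (F z)) \o shift p) (h *: v) - l (F p))) @ 0^' -->
    l ('D_v F p).
  rewrite E; have dF' : (fun h : R => h^-1 *: ((F \o shift p) (h *: v) - F p)) @ 0^' --> 'D_v F p.
    exact: dF.
  exact: (cvg_comp _ _ dF' (@cl _)).
by split; [apply/cvg_ex; exists (l ('D_v F p))|exact: cvg_lim C].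
Qed.

Hypotheses (oD : open D)
  (dF : forall p, D p -> derivable F p (1, 0) /\ derivable F p (0, 1))
  (c1 : {within D, continuous (fun p => 'D_(1, 0) F p)})
  (c2 : {within D, continuous (fun p => 'D_(0, 1) F p)}).

Lemma continuous_functional (G : R * R -> V) : {within D, continuous G} ->
  forall p, D p -> {for p, continuous (fun z => l (G z))}.
Proof.
rewrite continuous_open_subspace // => cG p /mem_set /cG h.
exact: (cvg_comp _ _ h (@cl _)).
Qed.

Lemma is_diff_functional p : D p ->
  is_diff p (fun z => l (F z)) (lin2 (l ('D_(1, 0) F p)) (l ('D_(0, 1) F p))).
Proof.
move=> Dp; have nD : \forall z \near p, D z by exact: open_nbhs_nbhs.
have E1 z : D z -> 'D_(1, 0) (fun z => l (F z)) z = l ('D_(1, 0) F z).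
  by move=> /dF[/is_derive_functional[]].
have E2 z : D z -> 'D_(0, 1) (fun z => l (F z)) z = l ('D_(0, 1) F z).
  by move=> /dF[_ /is_derive_functional[]].
rewrite -E1 // -E2 //; apply: is_diff_C1.
- by apply: filterS nD => z /dF[/is_derive_functional[? _] /is_derive_functional[? _]].
- have E : \forall z \near p, l ('D_(1, 0) F z) = 'D_(1, 0) (fun z => l (F z)) z.
    by apply: filterS nD => z /E1.
  rewrite /prop_for /continuous_at E1 //; apply: cvg_trans (near_eq_cvg E) _.
  exact: (continuous_functional c1 Dp).
- have E : \forall z \near p, l ('D_(0, 1) F z) = 'D_(0, 1) (fun z => l (F z)) z.
    by apply: filterS nD => z /E2.
  rewrite /prop_for /continuous_at E2 //; apply: cvg_trans (near_eq_cvg E) _.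
  exact: (continuous_functional c2 Dp).
Qed.
End LinearFunctional.

(** * Slice regular functions in plane coordinates *)

Section Slices.
Variable R : realType.
Implicit Types (I J c w x y : oct R) (p q z : R * R) (Omega : set (oct R)) (f : oct R -> oct R).

(** Passes from the Euclidean norm to the maximum norm, which carries the topology. *)
Lemma onormsq1_norm_le J : onormsq J = 1 -> `|J| <= 1.
Proof.
case: J => [[[a b] [c d]] [[a' b'] [c' d']]]; rewrite /onormsq /qnormsq /cnormsq /= => n1.
have le1 (t s : R) : t ^+ 2 + s = 1 -> 0 <= s -> `|t| <= 1.
  move=> ts s0; rewrite -(@ler_pXn2r _ 2) ?nnegrE // real_normK ?num_real // expr1n.
  by rewrite -ts lerDl.
rewrite !prod_normE /= !ge_max.
by rewrite (le1 a (b ^+ 2 + (c ^+ 2 + d ^+ 2) + (a' ^+ 2 + b' ^+ 2 + (c' ^+ 2 + d' ^+ 2))))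
  ?(le1 b (a ^+ 2 + (c ^+ 2 + d ^+ 2) + (a' ^+ 2 + b' ^+ 2 + (c' ^+ 2 + d' ^+ 2))))
  ?(le1 c (a ^+ 2 + (b ^+ 2 + d ^+ 2) + (a' ^+ 2 + b' ^+ 2 + (c' ^+ 2 + d' ^+ 2))))
  ?(le1 d (a ^+ 2 + (b ^+ 2 + c ^+ 2) + (a' ^+ 2 + b' ^+ 2 + (c' ^+ 2 + d' ^+ 2))))
  ?(le1 a' (a ^+ 2 + (b ^+ 2 + c ^+ 2) + (d ^+ 2 + b' ^+ 2 + (c' ^+ 2 + d' ^+ 2))))
  ?(le1 b' (a ^+ 2 + (b ^+ 2 + c ^+ 2) + (d ^+ 2 + a' ^+ 2 + (c' ^+ 2 + d' ^+ 2))))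
  ?(le1 c' (a ^+ 2 + (b ^+ 2 + c ^+ 2) + (d ^+ 2 + a' ^+ 2 + (b' ^+ 2 + d' ^+ 2))))
  ?(le1 d' (a ^+ 2 + (b ^+ 2 + c ^+ 2) + (d ^+ 2 + a' ^+ 2 + (b' ^+ 2 + c' ^+ 2)))) //;
  rewrite ?addr_ge0 ?sqr_ge0 //; rewrite -n1; ring.
Qed.

Lemma slice_pt_dist J p q : onormsq J = 1 ->
  `|slice_pt J p - slice_pt J q| <= `|p.1 - q.1| + `|p.2 - q.2|.
Proof.
move=> /onormsq1_norm_le J1.
have -> : slice_pt J p - slice_pt J q = oreal (p.1 - q.1) + (p.2 - q.2) *: J.
  rewrite /slice_pt scalerBl opprD addrACA; congr (_ + _).
  by congr (((_, _), (_, _)), ((_, _), (_, _))); rewrite /= ?subrr.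
apply: le_trans (ler_normD _ _) _; apply: lerD.
  by rewrite /oreal !prod_normE /= !normr0 !(max_l (normr_ge0 _)) ?maxxx ?max_l.
by rewrite normrZ ler_piMr.
Qed.

(** The estimate [slice_pt_dist] is independent of [J], so one neighbourhood serves all slices at
    once. *)
Lemma near_slice_pt (P : oct R -> Prop) p (w : oct R) :
  (forall J, im_units J -> slice_pt J p = w) ->
  (\forall w' \near w, P w') ->
  \forall z \near p, forall J, im_units J -> P (slice_pt J z).
Proof.
move=> pw /nbhs_ballP[d /= d0 Pd]; apply/near_prodP.
exists (d / 2); first by rewrite divr_gt0.
move=> z z1 z2 J iJ; apply: Pd; rewrite -ball_normE /= distrC -(pw J iJ).
apply: le_lt_trans (slice_pt_dist _ _ _) _; last by lra.
by have /im_unitsP[] := iJ.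
Qed.

Lemma continuous_slice_pt J : im_units J -> continuous (slice_pt J).
Proof.
move=> iJ p; apply/cvgrPdist_lt => e e0.
apply/near_prodP; exists (e / 2); first by rewrite divr_gt0.
move=> z z1 z2; apply: le_lt_trans (slice_pt_dist _ _ _) _.
  by have /im_unitsP[] := iJ.
by rewrite distrC [X in _ + X]distrC; lra.
Qed.

Lemma slice_preim_open Omega J : im_units J -> open Omega -> open (slice_pt J @^-1` Omega).
Proof.
move=> iJ oO; apply: open_comp => // z _; exact: continuous_slice_pt.
Qed.

(** Inner products with 1 and [J] recover the coordinates, so the preimage is a continuous image of
    the slice. *)
Lemma slice_preim_connected Omega J : im_units J -> connected (slice Omega J) ->
  connected (slice_pt J @^-1` Omega).
Proof.
move=> iJ cO; have /im_unitsP[J0 J1] := iJ.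
have -> : slice_pt J @^-1` Omega = (fun w => (oip (oreal 1) w, oip J w)) @` slice Omega J.
  have E z : (oip (oreal 1) (slice_pt J z), oip J (slice_pt J z)) = z.
    rewrite /slice_pt !oipDr !oipZr -onormsqE J1 mulr1.
    case: z => a b; congr pair; rewrite /oip /= J0; ring.
  apply/seteqP; split => [z Oz|_ [w [Ow [z _ zw]] <-]]; last by rewrite -zw E /= zw.
  by exists (slice_pt J z); rewrite ?E //; split => //; exists z.
apply: connected_continuous_connected => //.
apply: continuous_subspaceT => w.
exact: (cvg_pair (@continuous_oip _ (oreal 1) w) (@continuous_oip _ J w)).
Qed.

(** Slice regularity says [A = - I B] for the partial derivatives [A], [B]. As left multiplication
    by [I] is skew-adjoint with square [- 1], these are the Cauchy-Riemann equations of the pair. *)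
Lemma slice_regular_hol Omega f I c : open Omega -> slice_regular Omega f -> im_units I ->
  hol (slice_pt I @^-1` Omega) (fun p => oip c (f (slice_pt I p)))
    (fun p => oip (omul I c) (f (slice_pt I p))).
Proof.
move=> oO rf iI; have [df c1 c2 CR] := rf I iI.
have oD := slice_preim_open iI oO.
have dl d := is_diff_functional (oipBr d) (oipZr d) (@continuous_oip _ d) oD df c1 c2.
have cl d := continuous_functional (@continuous_oip _ d) oD c1.
exists (fun p => oip c ('D_(1, 0) (f \o slice_pt I) p)),
  (fun p => oip (omul I c) ('D_(1, 0) (f \o slice_pt I) p)) => p Dp.
have [dc dIc] := (dl c p Dp, dl (omul I c) p Dp).
have [cc cIc] := (cl c p Dp, cl (omul I c) p Dp).
have := CR p Dp; rewrite /=.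
move: ('D_(0, 1) _ p) dc dIc => B; set A := 'D_(1, 0) _ p => dc dIc CRp.
have {CRp} AE : A = - omul I B.
  apply/eqP; rewrite -addr_eq0; apply/eqP/oip_inj => d.
  have /eqP := congr1 (oip d) CRp.
  by rewrite oipZr !oip0 mulf_eq0 invr_eq0 pnatr_eq0 => /eqP.
split=> //.
- apply: (is_diff_eq dc); congr lin2.
  by rewrite AE oipNr opprK oip_imul // imulK // [oip (- c) _]oipC oipNr opprK oipC.
- apply: (is_diff_eq dIc); congr lin2.
  by rewrite AE oipNr oip_imul // opprK.
Qed.
End Slices.

(** * Minimum principle near a real point *)

Section MinimumPrinciple.
Variables (R : realType) (F : oct R -> R * R -> oct R) (e : oct R) (x0 r : R).
Implicit Types (I J c w x y : oct R) (p q z : R * R).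

Let p0 : R * R := (x0, 0).
Let B := [set z : R * R | dist2 z p0 < r].
Hypotheses (r0 : 0 < r) (im_units_e : im_units e).
Hypothesis hol_slice : forall J c, im_units J ->
  hol B (fun z => oip c (F J z)) (fun z => oip (omul J c) (F J z)).
Hypothesis sliceN : forall J z, F (- J) z = F J (z.1, - z.2).
Hypothesis slice_real : forall J (t : R), im_units J -> F J (t, 0) = F e (t, 0).

(* F J stands for f_J in the coordinates (x, y); [stem_re] and [stem_im] are the
   alpha and beta with f_J = alpha + J beta, computed on the slice of e. *)
Definition stem_re z := 2^-1 *: (F e z + F e (z.1, - z.2)).
Definition stem_im z := - omul e (2^-1 *: (F e z - F e (z.1, - z.2))).

(** The pair is half the sum of the holomorphic function of [oip c] on the slice of [e] and its
    Schwarz reflection. *)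
Lemma hol_stem c : hol B (fun z => oip c (stem_re z)) (fun z => oip c (stem_im z)).
Proof.
have h := hol_slice c im_units_e.
have h' : hol B (fun z => oip c (F e (z.1, - z.2)))
    (fun z => - oip (omul e c) (F e (z.1, - z.2))).
  apply: hol_sub (hol_conj h) => z; rewrite /B /dist2 /=.
  by rewrite !subr0 sqrrN.
have := holM (hol_cst B 2^-1 0) (holD h h').
congr hol; apply/funext => z.
  rewrite /stem_re oipZr oipDr.
  by move: (oip _ _) (oip _ _) (oip _ _) (oip _ _) => *; ring.
rewrite /stem_im oipNr oip_imul // opprK oipZr oipBr.
by move: (oip _ _) (oip _ _) (oip _ _) (oip _ _) => *; ring.
Qed.

(** Tested against [c], the difference of the two sides is the real part of a holomorphic function
    that vanishes on the real axis, hence on the upper half-disc. Replacing [J] by [- J] and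
    conjugating [z] covers the lower half. *)
Lemma representation_formula J z : im_units J -> dist2 z p0 < r / 16 ->
  F J z = stem_re z + omul J (stem_im z).
Proof.
have upper J' z' : im_units J' -> dist2 z' p0 < r / 16 -> 0 <= z'.2 ->
    F J' z' = stem_re z' + omul J' (stem_im z').
  move=> iJ zr z2; apply: oip_inj => c; apply/subr0_eq.
  (* The last term is [- i] times the stem pair of [J' c]; its real part [oip (J' c) beta] equals
     [- oip c (J' beta)]. *)
  have h := holD (hol_slice c iJ) (holD (holM (hol_cst B (-1) 0) (hol_stem c))
    (holM (hol_cst B 0 (-1)) (hol_stem (omul J' c)))).
  have [q|] := hol_real_axis h (erefl : p0.2 = 0) r0 (fun z Bz => Bz) _ zr z2.
    move=> Bq q2.
    have Eq : q = (q.1, 0) by rewrite -q2 -surjective_pairing.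
    have -> : stem_im q = 0.
      rewrite /stem_im Eq /= oppr0 subrr scaler0.
      by rewrite omul0 // oppr0.
    have -> : F J' q = stem_re q.
      rewrite Eq /stem_re /= oppr0 slice_real //.
      by rewrite scale_half.
    by rewrite !oip0; move: (oip _ _) (oip _ _) => *; split; ring.
  rewrite oipDr oip_imul // => + _.
  by move: (oip _ _) (oip _ _) (oip _ _) => ? ? ? <-; ring.
move=> iJ zr; case: (leP 0 z.2) => [|z2]; first exact: upper.
have -> : F J z = F (- J) (z.1, - z.2).
  by rewrite sliceN /= opprK -surjective_pairing.
have zr' : dist2 (z.1, - z.2) p0 < r / 16 by move: zr; rewrite /dist2 /= !subr0 sqrrN.
have z2' : 0 <= (z.1, - z.2).2 by rewrite oppr_ge0 ltW.
rewrite (upper _ _ (im_unitsN iJ) zr' z2').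
have -> : stem_re (z.1, - z.2) = stem_re z.
  by rewrite /stem_re /= opprK -surjective_pairing addrC.
have -> : stem_im (z.1, - z.2) = - stem_im z.
  by rewrite /stem_im /= opprK -surjective_pairing -opprB scalerN omulNr.
by rewrite omulNN.
Qed.

Let a0 := F e p0.
Let m := onormsq a0.
Hypothesis m0 : 0 < m.
Hypothesis hmin : forall J z, im_units J -> B z -> m <= onormsq (F J z).

Lemma stem_re0 : stem_re p0 = a0.
Proof.
rewrite /stem_re /= oppr0 -/p0 -/a0.
by rewrite scale_half.
Qed.

Lemma stem_im0 : stem_im p0 = 0.
Proof.
rewrite /stem_im /p0 /= oppr0 subrr scaler0.
by rewrite omul0 // oppr0.
Qed.

(** The sum of the squares of the eight coordinates of [alpha + i beta]. *)
Lemma hol_stem_norm : hol B (fun z => onormsq (stem_re z) - onormsq (stem_im z))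
  (fun z => 2 * oip (stem_re z) (stem_im z)).
Proof.
have sq c := holM (hol_stem c) (hol_stem c).
have := holD (holD (holD (sq (oct8 1 0 0 0 0 0 0 0)) (sq (oct8 0 1 0 0 0 0 0 0)))
                   (holD (sq (oct8 0 0 1 0 0 0 0 0)) (sq (oct8 0 0 0 1 0 0 0 0))))
             (holD (holD (sq (oct8 0 0 0 0 1 0 0 0)) (sq (oct8 0 0 0 0 0 1 0 0)))
                   (holD (sq (oct8 0 0 0 0 0 0 1 0)) (sq (oct8 0 0 0 0 0 0 0 1)))).
congr hol; apply/funext => z; move: (stem_re z) (stem_im z) => x y;
  rewrite /onormsq /qnormsq /cnormsq /oip /=; ring.
Qed.

(** Let [N] be the function of [hol_stem_norm]. Modulus 1 for [m / N] would leave its phase open, so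
    the strong maximum principle is applied to [k = (1 + m / N) / 2]: [|k| <= 1], [k = 1] at [p0],
    and [|k| = 1] forces [m / N = 1]. The second part of [slice_sphere_min] then gives
    [beta = 0]. *)
Lemma stem_im_eq0 z : dist2 z p0 < r / 64 -> onormsq (stem_re z) = m /\ stem_im z = 0.
Proof.
(* Here [s] stands for [|m / N|^2] and [t] for the real part of [m / N], so the quotient is
   [|k|^2]. *)
have aux (s t : R) : s <= 1 -> t <= 1 -> (1 + 2 * t + s) / 4 = 1 -> s = 1 /\ t = 1.
  by move=> s1 t1 st; split; lra.
have aux' (s t : R) : s <= 1 -> t <= 1 -> (1 + 2 * t + s) / 4 <= 1.
  by move=> s1 t1; lra.
pose S1 z := onormsq (stem_re z) - onormsq (stem_im z).
pose S2 z := 2 * oip (stem_re z) (stem_im z).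
pose B' := [set z | dist2 z p0 < r / 16].
have B'B : B' `<=` B by move=> q; rewrite /B' /B /=; have := r0; lra.
have key q : B' q -> m ^+ 2 <= S1 q ^+ 2 + S2 q ^+ 2 /\
    (0 < m -> S1 q = m -> oip (stem_re q) (stem_im q) = 0 -> stem_im q = 0).
  move=> Bq; apply: slice_sphere_min; first exact: ltW.
  by move=> J iJ; rewrite -representation_formula //; apply: hmin => //; exact: B'B.
have n0 q : B' q -> 0 < S1 q ^+ 2 + S2 q ^+ 2.
  by move=> /key[h _]; apply: lt_le_trans h; rewrite exprn_gt0.
have hN : hol B' S1 S2 := hol_sub B'B hol_stem_norm.
have hk := holM (hol_cst B' 2^-1 0) (holD (hol_cst B' 1 0)
  (holM (hol_cst B' m 0) (holV (fun q Bq => lt0r_neq0 (n0 q Bq)) hN))).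
have bd (s1 s2 : R) : m ^+ 2 <= s1 ^+ 2 + s2 ^+ 2 -> 0 < s1 ^+ 2 + s2 ^+ 2 ->
   m ^+ 2 / (s1 ^+ 2 + s2 ^+ 2) <= 1 /\ m * (s1 / (s1 ^+ 2 + s2 ^+ 2)) <= 1.
  move=> h n0'.
  have h1 : m ^+ 2 / (s1 ^+ 2 + s2 ^+ 2) <= 1 by rewrite ler_pdivrMr // mul1r.
  split=> //; rewrite mulrA ler_pdivrMr // mul1r.
  by have := sqr_ge0 (m - s1); have := sqr_ge0 s2; nra.
have kE (s1 s2 : R) : 0 < s1 ^+ 2 + s2 ^+ 2 ->
    (2^-1 * (1 + (m * (s1 / (s1 ^+ 2 + s2 ^+ 2)) - 0 * (- s2 / (s1 ^+ 2 + s2 ^+ 2)))) -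
     0 * (0 + (m * (- s2 / (s1 ^+ 2 + s2 ^+ 2)) + 0 * (s1 / (s1 ^+ 2 + s2 ^+ 2))))) ^+ 2 +
    (2^-1 * (0 + (m * (- s2 / (s1 ^+ 2 + s2 ^+ 2)) + 0 * (s1 / (s1 ^+ 2 + s2 ^+ 2)))) +
     0 * (1 + (m * (s1 / (s1 ^+ 2 + s2 ^+ 2)) - 0 * (- s2 / (s1 ^+ 2 + s2 ^+ 2))))) ^+ 2 =
    (1 + 2 * (m * (s1 / (s1 ^+ 2 + s2 ^+ 2))) + m ^+ 2 / (s1 ^+ 2 + s2 ^+ 2)) / 4.
  by move=> /lt0r_neq0 ?; field.
move=> zr.
have zr' : dist2 z p0 < r / 16 / 4 by have := r0; lra.
have Bz : B' z by rewrite /B' /=; have := r0; lra.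
have S10 : S1 p0 = m.
  by rewrite /S1 stem_re0 stem_im0 -/m /onormsq /qnormsq /cnormsq /= expr0n !addr0 subr0.
have S20 : S2 p0 = 0 by rewrite /S2 stem_im0 /oip /=; ring.
have := hol_max_interior hk (fun q Bq => Bq) _ _ zr'.
rewrite /= !kE; last 2 first.
- exact: n0.
- by rewrite S10 S20 expr0n addr0 exprn_gt0.
move=> H.
have {H} : (1 + 2 * (m * (S1 z / (S1 z ^+ 2 + S2 z ^+ 2))) + m ^+ 2 / (S1 z ^+ 2 + S2 z ^+ 2)) / 4 = 1.
  apply: H => [q qr|].
    have [k1 _] := key q qr; have k2 := n0 q qr.
    rewrite kE //; have [] := bd _ _ k1 k2; exact: aux'.
  by rewrite S10 S20 expr0n addr0; field; exact: lt0r_neq0.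
have [k1 k3] := key z Bz; have k2 := n0 z Bz.
have [b1 b2] := bd _ _ k1 k2.
move=> E.
have [E1 E2] := aux _ _ b1 b2 E.
have N1 : S1 z ^+ 2 + S2 z ^+ 2 = m ^+ 2.
  by rewrite -[LHS]mul1r -E1 divfK // gt_eqF.
rewrite N1 in E2.
have S1m : S1 z = m.
  transitivity (m * (S1 z / m ^+ 2) * m); last by rewrite E2 mul1r.
  by field; exact: lt0r_neq0.
have S2z : oip (stem_re z) (stem_im z) = 0.
  move/eqP: N1; rewrite S1m addrC -subr_eq0 addrK sqrf_eq0 /S2 mulf_eq0 pnatr_eq0 /=.
  by move/eqP.
have im0 := k3 m0 S1m S2z; split => //.
by rewrite -S1m /S1 im0 /onormsq /qnormsq /cnormsq /= expr0n !addr0 subr0.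
Qed.

(** Where [beta = 0] and [|alpha|^2 = m], the function [oip a0 alpha / m] is real, of modulus at
    most 1, and 1 at [p0]. Averaging with 1 as before shows that it is 1, and equality in
    Cauchy-Schwarz gives [alpha = a0]. *)
Lemma stem_re_eq z : dist2 z p0 < r / 256 -> stem_re z = a0.
Proof.
have aux1 (s : R) : (1 + s) / 2 = 1 -> s = 1 by lra.
have aux2 (s : R) : -1 <= s -> (1 + s) / 2 <> -1 by move=> h1 h2; lra.
pose B' := [set z | dist2 z p0 < r / 64].
have B'B : B' `<=` B by move=> q; rewrite /B' /B /=; have := r0; lra.
have hk := holM (hol_cst B' 2^-1 0) (holD (hol_cst B' 1 0)
  (holM (hol_cst B' m^-1 0) (hol_sub B'B (hol_stem a0)))).
have oE x : onormsq (x - a0) = onormsq x + m - 2 * oip a0 x.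
  by rewrite /m !onormsqE oipBr ![oip (x - _) _]oipC !oipBr [oip x a0]oipC; ring.
have oE' x : onormsq (x + a0) = onormsq x + m + 2 * oip a0 x.
  by rewrite /m !onormsqE oipDr ![oip (x + _) _]oipC !oipDr [oip x a0]oipC; ring.
move=> zr; have zr' : dist2 z p0 < r / 64 / 4 by have := r0; lra.
have := hol_max_interior hk (fun q Bq => Bq) _ _ zr'.
have kE (t : R) : (2^-1 * (1 + (m^-1 * t - 0 * 0)) - 0 * (0 + (m^-1 * 0 + 0 * t))) ^+ 2 +
   (2^-1 * (0 + (m^-1 * 0 + 0 * t)) + 0 * (1 + (m^-1 * t - 0 * 0))) ^+ 2 =
   ((1 + m^-1 * t) / 2) ^+ 2 by field; exact: lt0r_neq0.
have Bz : B' z by rewrite /B' /=; have := r0; lra.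
have [nz iz] := stem_im_eq0 Bz.
rewrite /= iz stem_im0 stem_re0 !oip0 !kE -onormsqE -/m mulVf ?lt0r_neq0 //.
move=> H.
have {H} : ((1 + m^-1 * oip a0 (stem_re z)) / 2) ^+ 2 = 1.
  apply: H => [q /stem_im_eq0[nq ->]|]; last by field.
  rewrite oip0 kE.
  have h1 := onormsq_ge0 (stem_re q - a0); have h2 := onormsq_ge0 (stem_re q + a0).
  rewrite oE nq in h1; rewrite oE' nq in h2.
  have : m^-1 * oip a0 (stem_re q) <= 1 by rewrite ler_pdivrMl // mulr1; lra.
  have : -1 <= m^-1 * oip a0 (stem_re q) by rewrite ler_pdivlMl //; lra.
  by nra.
have h1 := onormsq_ge0 (stem_re z - a0); have h2 := onormsq_ge0 (stem_re z + a0).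
rewrite oE nz in h1; rewrite oE' nz in h2.
have : -1 <= m^-1 * oip a0 (stem_re z) by rewrite ler_pdivlMl //; lra.
move=> h3 /eqP; rewrite sqrf_eq1 => /orP[]/eqP h4; last by have := aux2 _ h3 h4.
have h5 := aux1 _ h4.
have h6 : oip a0 (stem_re z) = m.
  by rewrite -[RHS]mulr1 -h5 mulVKf // lt0r_neq0.
by apply/subr0_eq/onormsq_eq0; rewrite oE nz h6; ring.
Qed.

Lemma slice_constant_near J z : im_units J -> dist2 z p0 < r / 256 -> F J z = a0.
Proof.
move=> iJ zr; have z16 : dist2 z p0 < r / 16 by have := r0; lra.
have z64 : dist2 z p0 < r / 64 by have := r0; lra.
have [_ i0] := stem_im_eq0 z64.
rewrite (representation_formula iJ z16) i0 (stem_re_eq zr) -[RHS]addr0.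
by rewrite omul0.
Qed.
End MinimumPrinciple.

(** * From the real point to the whole domain *)

Lemma exists_slice (R : realType) (w : oct R) :
  exists J z, im_units J /\ slice_pt J z = w.
Proof.
case: w => [[[a b] [c d]] [[a' b'] [c' d']]].
pose v := oct8 0 b c d a' b' c' d'.
have [v0|v0] := eqVneq (onormsq v) 0.
  exists (oct8 0 1 0 0 0 0 0 0), (a, 0); split; first exact: im_units_i.
  have [-> -> -> -> -> -> ->] := onormsq_eq0 v0.
  by congr (((_, _), (_, _)), ((_, _), (_, _))); rewrite /= /GRing.scale /=; ring.
have vp : 0 < onormsq v by rewrite lt_neqAle eq_sym v0 onormsq_ge0.
have sp : 0 < Num.sqrt (onormsq v) by rewrite sqrtr_gt0.
have sq := sqr_sqrtr (ltW vp).
exists ((Num.sqrt (onormsq v))^-1 *: v), (a, Num.sqrt (onormsq v)); split.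
  apply/im_unitsP; split; first by rewrite /= scaler0.
  rewrite onormsqE oipZr oipC oipZr -onormsqE -[in X in _ * (_ * X)]sq.
  by field; rewrite gt_eqF.
rewrite /slice_pt /= scalerA divff ?gt_eqF // scale1r.
by congr (((_, _), (_, _)), ((_, _), (_, _))); rewrite /= ?addr0 ?add0r.
Qed.

Theorem theorem1p7 (R : realType) (Omega : set (oct R)) (f : oct R -> oct R)
    (hOmega : symmetric_slice_domain Omega) (hf : slice_regular Omega f)
    (w0 : oct R) (hw0 : (Omega `&` @real_axis R) w0)
    (hmin : local_min_on Omega (fun w => onorm (f w)) w0) :
  f w0 = 0 \/ constant_on Omega f.
Proof.
have [f0|f0] := eqVneq (onormsq (f w0)) 0; first by left; exact: onormsq_eq0.
right; exists (f w0).
have [Ow0 [x0 _ xw0]] := hw0.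
have m0 : 0 < onormsq (f w0) by rewrite lt_neqAle eq_sym f0 onormsq_ge0.
have [[_ _ oO] _ cO _] := hOmega.
have nO : \forall w \near w0, Omega w by exact: open_nbhs_nbhs.
have near0 : \forall w \near w0, Omega w /\ onormsq (f w0) <= onormsq (f w).
  apply: filterS2 nO hmin => w Ow /(_ Ow); rewrite /onorm => h; split => //.
  by rewrite -ler_sqrt // onormsq_ge0.
have pt_real (J : oct R) (t : R) : slice_pt J (t, 0) = oreal t.
  by rewrite /slice_pt /= scale0r addr0.
have sw0 (J : oct R) : im_units J -> slice_pt J (x0, 0) = w0.
  by move=> _; rewrite pt_real.
(* One radius for all slices, as [w0] is real and has the coordinates [(x0, 0)] in each of them. *)
have /near_dist2P[r r0 rH] := near_slice_pt sw0 near0.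
have iE := im_units_i R.
have hol_f (J c : oct R) (iJ : im_units J) := slice_regular_hol c oO hf iJ.
have f_near (J : oct R) z : im_units J -> dist2 z (x0, 0) < r / 256 -> f (slice_pt J z) = f w0.
  move=> iJ zr; rewrite -(sw0 _ iE).
  apply: (@slice_constant_near R (fun J z => f (slice_pt J z)) _ x0 r) => //.
  - move=> J' c iJ'; apply: hol_sub (hol_f J' c iJ') => y /ltW/rH/(_ J' iJ')[] //.
  - by move=> J' y; rewrite /slice_pt /= scalerN scaleNr.
  - by move=> J' t iJ'; rewrite !pt_real.
  - by rewrite sw0.
  - by move=> J' y iJ' /ltW/rH/(_ J' iJ')[_]; rewrite sw0.
(* Some slice contains both [w] and [w0]. Subtracting the constant in both components of the
   holomorphic pair makes the whole pair vanish near [(x0, 0)], as the identity principle asks. *)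
move=> w Ow; have [J [z [iJ zw]]] := exists_slice w.
rewrite -zw; apply: oip_inj => c; apply/subr0_eq.
have hd := holD (hol_f J c iJ) (hol_cst _ (- oip c (f w0)) (- oip (omul J c) (f w0))).
have [_ cJ _] := cO J iJ.
have Op0 : (slice_pt J @^-1` Omega) (x0, 0) by rewrite /= sw0.
have zero : \forall q \near (x0, 0 : R), oip c (f (slice_pt J q)) + - oip c (f w0) = 0 /\
    oip (omul J c) (f (slice_pt J q)) + - oip (omul J c) (f w0) = 0.
  have : dist2 (x0, 0) (x0, 0) < r / 256 by rewrite /dist2 !subrr expr0n addr0 divr_gt0.
  by move/near_dist2_lt; apply: filterS => q /(f_near J q iJ) ->; rewrite !subrr.
have Oz : (slice_pt J @^-1` Omega) z by rewrite /= zw.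
by have [] := hol_identity (slice_preim_open iJ oO) (slice_preim_connected iJ cJ) hd Op0 zero Oz.
Qed.
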